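(* Let $p\equiv 1\pmod{4}$ be a prime power. Then there exists an elementary $(\mathbb{F}_{p}^+ \times \mathbb{F}_{q}^+,\mathbb{F}_{p}^+\times \{0\},p+1,1)$-FDF for any prime power $q\equiv 1 \pmod{2p+2}$ with $q>Q(p+1,p)$.
   Context: Unions of (multi)sets are multiset unions, and $\underline{h}A$ denotes the multiset union of $h$ copies of $A$. $\mathbb{F}_q^+$ is the additive group of the finite field $\mathbb{F}_q$. For positive integers $d,m$, $$Q(d,m)=\tfrac14\left(U+\sqrt{U^2+4d^{m-1}m}\right)^2,\qquad U=\sum_{h=1}^m \binom{m}{h}(d-1)^h(h-1).$$ Frame difference family: let $H$ be a finite abelian group with a subgroup $N$ of order $n$. An $(H,N,k,\lambda)$-DF (relative difference family) is a family $\mathfrak{B}=[B_1,\dots,B_r]$ of $k$-subsets of $H$ (base blocks) such that the multiset $\bigcup_{i=1}^r[x-y:x,y\in B_i,\ x\neq y]$ equals $\underline{\lambda}(H\setminus N)$. It is an $(H,N,k,\lambda)$-FDF if it can be partitioned into $\lambda n/(k-1)$ subfamilies, each consisting of $(|H|-n)/(nk)$ base blocks, such that the union of the base blocks in each subfamily is a system of representatives for the nontrivial cosets of $N$ in $H$. The FDF is elementary if $\lambda n=k-1$. *)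

(* Defs.v *)
From HB Require Import structures.
From mathcomp Require Import all_boot all_order all_fingroup all_algebra all_field.

Set Implicit Arguments.
Unset Strict Implicit.
Unset Printing Implicit Defensive.

Import GRing.Theory Num.Theory.

Definition prime_power (n : nat) : Prop :=
  exists l e : nat, [/\ prime l, 0 < e & n = l ^ e].

Section Bound.
Variable R : rcfType.
Local Open Scope ring_scope.

Definition Usum (d m : nat) : R :=
  \sum_(1 <= h < m.+1) 'C(m, h)%:R * (d%:R - 1) ^+ h * (h%:R - 1).

Definition Qbound (d m : nat) : R :=
  let U := Usum d m in
  4^-1 * (U + Num.sqrt (U ^+ 2 + 4 * d%:R ^+ (m - 1) * m%:R)) ^+ 2.

End Bound.

(* Multisets are sequences up to [perm_eq]; a family of blocks is a sequence of
   sets, so repeated base blocks are allowed.  The ambient group [H] is the whole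
   [finGroupType] [gT], written multiplicatively, so that the difference x - y
   is [x * y^-1]. *)
Section DifferenceFamilies.
Variables (gT : finGroupType) (N : {group gT}) (k lambda : nat).
Local Open Scope group_scope.

Implicit Types (B : {set gT}) (Bs : seq {set gT}).

Definition block_diffs B : seq gT :=
  [seq x * y^-1 | x <- enum B, y <- enum (B :\ x)].

Definition is_DF Bs : Prop :=
  [/\ abelian [set: gT],
      forall B, B \in Bs -> #|B| = k &
      perm_eq (flatten [seq block_diffs B | B <- Bs])
              (flatten (nseq lambda (enum (~: N))))].

Definition nontrivial_coset_reps (s : seq gT) : Prop :=
  perm_eq [seq N :* x | x <- s]
          (enum (rcosets N [set: gT] :\ (N : {set gT}))).

(* The numbers of subfamilies, lambda n / (k - 1), and of blocks in each of
   them, (|H| - n) / (n k), appear with denominators cleared: division on [nat]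
   would round. *)
Definition is_FDF Bs : Prop :=
  is_DF Bs /\
  exists parts : seq (seq {set gT}),
    [/\ perm_eq (flatten parts) Bs,
        (size parts * (k - 1) = lambda * #|N|)%N &
        forall P, P \in parts ->
          (size P * (#|N| * k) = #|gT| - #|N|)%N /\
          nontrivial_coset_reps (flatten [seq enum (B : {set gT}) | B <- P])].

Definition is_elementary_FDF Bs : Prop :=
  is_FDF Bs /\ (lambda * #|N| = k - 1)%N.

End DifferenceFamilies.

(* F^+ x {0} in F^+ x K^+.  The [finGroupType] carried by a finite field is its
   additive group, so [[set: F]] is F^+ and [1] is its trivial subgroup {0}. *)
Definition first_factor (F K : finFieldType) : {group F * K} :=
  setX_group [set: F]%G [1 K]%G.

(* Main.v *)
Require Import Defs.
From mathcomp Require Import all_boot all_order all_fingroup all_algebra all_field.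
From mathcomp Require Import cyclic zify ring lra.

Set Implicit Arguments.
Unset Strict Implicit.
Unset Printing Implicit Defensive.

Import Order.TTheory GRing.Theory Num.Theory.
Local Open Scope ring_scope.

(** Write q for the order of K, p for the order of F, d = p + 1, and call class
    of a nonzero y in K its coset modulo the group D of d-th powers; since 2d
    divides q - 1, the group D contains -1 and y, -y have the same class.

    The construction.  Let A' be the set of the squares of F (0 included) and A''
    the set of the nonsquares together with 0.  Each has d / 2 elements, and a
    computation with the quadratic character shows that for every delta <> 0
    there are exactly d / 2 pairs (a, a + delta) inside A' or inside A''
    ([card_paley_edges]).  Attach to each a in A', and to each a in A'', a label
    l(a) in K (so 0 receives two labels), and take as base blocks the sets {(a, e s l(a)) : a, e = 1 or -1}, with s running
    over representatives S of D modulo {1, -1}.  The differences with first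
    coordinate delta are (delta, e s (l(a + delta) - l(a))) and
    (delta, e s (l(a + delta) + l(a))), and e s runs over D.  So the blocks form
    the desired family as soon as the d labels lie in the d different classes, and
    for each delta so do the d numbers l(a + delta) - l(a), l(a + delta) + l(a)
    ([base_blocks_FDF]).

    The labels.  Fix in advance which class each of these numbers has to occupy
    and choose the labels one after the other ([labelling]).  A new label x in A'
    or A'' must satisfy one condition on its own class and two conditions, on the
    classes of x - l(u) and x + l(u), for each of the at most (d / 2) - 1 earlier
    labels: at most p conditions of the form that x - b lies in a given class,
    with different points b.  Such an x exists because q exceeds Q(d, p)
    ([prescribed_classes]): the number of solutions is expanded in characters of
    order dividing d, and every sum over x of a product of h nontrivial
    characters at h different shifts is at most (h - 1) sqrt q in absolute value.

    The Weil bound ([weil_bound]).  Let chi_f be the product in question,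
    extended to the monic polynomials as a multiplicative function.  Its sum over
    the monic polynomials of degree n vanishes for n >= h ([lcoef_eq0]), hence the
    generating function is a polynomial of degree less than h.  Counting the
    factors of a monic polynomial ([factor_countE]) shows that minus the n-th
    power sum of its inverse roots is the analogous character sum over the field
    with q^n elements ([lcoef_newton], [newton_identity]).  If these sums are
    O(q^(n / 2)), for n even, then every inverse root has modulus at most sqrt q
    ([power_sums_bound]), whatever the implied constant is, and the case n = 1 of
    the formula for the power sums gives the bound.

    The estimate O(q^(n / 2)) is Stepanov's method ([stepanov_bound]).  Over a
    field with s^2 elements one constructs a nonzero polynomial of small degree
    whose s-th power vanishes at all the points at which the character takes a
    given value.  That the polynomial is not zero is an independence statement
    ([powers_independent]), reduced by a resultant to the irreducibility of
    Y^d - f(z) over the rational functions in z, where f is the product of the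
    (X - b)^(e b) attached to the character. *)

(** * Algebra over a field of rational functions *)

Lemma nontrivial_relation (F : fieldType) (T : finType) (P : T -> {poly F}) n :
    (forall t, size (P t) <= n)%N -> (n < #|T|)%N ->
  exists2 c : T -> F, exists t, c t != 0 & \sum_t c t *: P t = 0.
Proof.
move=> szP ltnT.
pose A := \matrix_(i < #|T|) poly_rV (P (enum_val i)) : 'M[F]_(_, n).
have: kermx A != 0.
  rewrite kermx_eq0 /row_free neq_ltn; apply/orP; left.
  exact: leq_ltn_trans (rank_leq_col A) ltnT.
case/rowV0Pn=> v /sub_kermxP vA0 nz_v.
exists (fun t => v 0 (enum_rank t)).
  have /rV0Pn [i nz_i] := nz_v.
  by exists (enum_val i); rewrite enum_valK.
rewrite (reindex _ (onW_bij _ (enum_val_bij T))) /=.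
transitivity (rVpoly (v *m A)); last by rewrite vA0 linear0.
rewrite mulmx_sum_row linear_sum; apply: eq_bigr => i _.
by rewrite linearZ /= enum_valK rowK poly_rV_K.
Qed.

Lemma fraction_divP (R : idomainType) (w : {fraction R}) :
  exists a b, b != 0 /\ w * tofrac b = tofrac a.
Proof.
elim/quotW: w => x; exists x.1, x.2; split; first exact: denom_ratioP.
unlock tofrac; rewrite -[LHS]FracField.pi_mul; apply/eqmodP => /=.
rewrite /FracField.equivf /FracField.mulf /= !numden_Ratio ?(oner_neq0, mulr1, mul1r) ?denom_ratioP //.
by rewrite mulrC.
Qed.

(** The companion matrix M of a factor G of Y^d - u satisfies M^d = u, so its
    determinant is a d-th root of u^(deg G) lying in the base field. *)
Lemma norm_of_binomial_factor (E : fieldType) d (u : E) (G : {poly E}) :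
    (1 < size G)%N -> G %| 'X^d - u%:P ->
  exists w, w ^+ d = u ^+ (size G).-1.
Proof.
move=> szG dvdG.
have nzG: G != 0 by rewrite -size_poly_gt0 ltnW.
pose G1 := (lead_coef G)^-1 *: G.
have monG1: G1 \is monic by rewrite monicE lead_coefZ mulVf ?lead_coef_eq0.
have szG1: size G1 = size G by rewrite size_scale // invr_eq0 lead_coef_eq0.
have dvdG1: G1 %| 'X^d - u%:P by rewrite dvdpZl ?invr_eq0 ?lead_coef_eq0.
rewrite -szG1 in szG *; move: G1 monG1 szG dvdG1 {szG1 nzG dvdG} => {}G monG szG.
case/dvdpP=> H defH.
exists (\det (companionmx G)).
have := companionmxK monG.
move: (companionmx G); case: (size G).-1 (prednK (ltnW szG)) => [|r] Er.
  by move: szG; rewrite -Er.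
move=> M charM.
have: horner_mx M ('X^d - u%:P) = 0.
  by rewrite defH rmorphM -[in X in _ * X]charM /= Cayley_Hamilton mulr0.
rewrite rmorphB /= horner_mx_C rmorphXn /= horner_mx_X => /subr0_eq MdE.
by rewrite -(det_scalar _ u) -MdE; elim: d {defH MdE} => [|d IHd];
  rewrite ?det1 ?expr0 // !exprS det_mulmx IHd.
Qed.

Lemma mupX (F : fieldType) x (p : {poly F}) n :
  p != 0 -> mup x (p ^+ n) = (n * mup x p)%N.
Proof.
move=> nz_p; elim: n => [|n IHn]; first by rewrite expr0 mupNroot ?root1.
by rewrite exprS mupM ?expf_neq0 // IHn mulSn.
Qed.

Section BinomialCoprime.
Variables (F : fieldType) (I : finType) (b : I -> F) (e : I -> nat).
Hypothesis b_inj : injective b.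

(** The exponents may vanish, so that b can enumerate a whole field. *)
Definition root_prod : {poly F} := \prod_i ('X - (b i)%:P) ^+ e i.

Lemma root_prod_neq0 : root_prod != 0.
Proof. by apply/prodf_neq0=> i _; rewrite expf_neq0 ?polyXsubC_eq0. Qed.

Lemma size_root_prod : size root_prod = (\sum_i e i).+1.
Proof.
rewrite size_prod; last by move=> i _; rewrite expf_neq0 ?polyXsubC_eq0.
rewrite (eq_bigr (fun i => e i + 1)%N) => [|i _]; last first.
  by rewrite size_exp_XsubC addn1.
by rewrite big_split /= sum1_card subSn ?leq_addl // addnK.
Qed.

Lemma mup_root_prod i : mup (b i) root_prod = e i.
Proof.
have nzX j : ('X - (b j)%:P) ^+ e j != 0 by rewrite expf_neq0 ?polyXsubC_eq0.
have nz_rest : \prod_(j | j != i) ('X - (b j)%:P) ^+ e j != 0.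
  by apply/prodf_neq0.
rewrite /root_prod (bigD1 i) //= mupM // mup_XsubCX eqxx mupNroot ?addn0 //.
rewrite rootE horner_prod; apply/prodf_neq0 => j ne_ji.
by rewrite horner_exp hornerXsubC expf_neq0 // subr_eq0 (inj_eq b_inj) eq_sym.
Qed.

(** The condition on e says that u = c f is not a proper power for any divisor of
    d, which makes Y^d - u irreducible.  Indeed, if it had a factor of degree r
    with 0 < r < d, then u^r would be a d-th power by [norm_of_binomial_factor],
    and comparing multiplicities at each b i gives that d divides r e i for
    all i, hence d divides r. *)
Lemma binomial_coprime d (c : F) (A : {poly {fraction {poly F}}}) :
    c != 0 -> (forall r, (forall i, d %| r * e i) -> d %| r)%N ->
    A != 0 -> (size A <= d)%N ->
  coprimep A ('X^d - (tofrac (c *: root_prod))%:P).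
Proof.
move=> nz_c gcd_e nz_A szA; rewrite /coprimep -[_ == _]negbK; apply/negP.
set B := _ - _; set G := gcdp A B => szG.
have{} szG : (1 < size G)%N.
  by rewrite ltn_neqAle eq_sym szG size_poly_gt0 gcdp_eq0 (negPf nz_A).
have szGA: (size G <= size A)%N by rewrite dvdp_leq ?dvdp_gcdl.
have [w wE] := norm_of_binomial_factor szG (dvdp_gcdr A B).
have [a [b' [nz_b wab]]] := fraction_divP w.
have nz_f := root_prod_neq0.
have nz_cf : c *: root_prod != 0 by rewrite scaler_eq0 negb_or nz_c.
have abE : a ^+ d = (c *: root_prod) ^+ (size G).-1 * b' ^+ d.
  by apply/eqP; rewrite -tofrac_eq rmorphM !rmorphXn /= -wE -wab exprMn.
have nz_a : a != 0.
  have: a ^+ d != 0 by rewrite abE mulf_neq0 ?expf_neq0.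
  by apply: contraNneq => ->; rewrite expr0n -(subnKC (leq_trans szG (leq_trans szGA szA))).
have: (d %| (size G).-1)%N.
  apply: gcd_e => i; have /(congr1 (mup (b i))) := abE.
  rewrite mupM ?expf_neq0 // !mupX // -mul_polyC mupMr ?mup_root_prod.
    by move=> Ed; rewrite -(dvdn_addl _ (dvdn_mulr (mup (b i) b') (dvdnn d))) -Ed dvdn_mulr.
  by rewrite rootC.
move/dvdn_leq => /(_ _)/wrap[]; first by rewrite -ltnS prednK // ltnW.
by rewrite leqNgt prednK ?(leq_trans szGA) // ltnW.
Qed.
End BinomialCoprime.

(** * Independence of powers modulo a lacunary substitution *)

Section InnerDegree.
Variable R : comNzRingType.
Implicit Types p q : {poly {poly R}}.

(** A polynomial in z with coefficients in R[x] has x-degree at most n. *)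
Definition inner_deg_le n p := forall k, (size (p`_k)%R <= n.+1)%N.

Lemma inner_deg_le_sum (I : Type) (r : seq I) (P : pred I) (G : I -> {poly {poly R}}) n :
  (forall i, P i -> inner_deg_le n (G i)) -> inner_deg_le n (\sum_(i <- r | P i) G i).
Proof.
move=> leG; elim/big_ind: _ => [k|p q lep leq_ k|//]; first by rewrite coef0 size_poly0.
by rewrite coefD (leq_trans (size_polyD _ _)) // geq_max lep leq_.
Qed.

Lemma inner_deg_leM m n p q :
  inner_deg_le m p -> inner_deg_le n q -> inner_deg_le (m + n) (p * q).
Proof.
move=> lep leq_ k; rewrite coefM; apply: leq_trans (size_sum _ _ _) _.
apply/bigmax_leqP => i _; apply: leq_trans (size_polyMleq _ _) _.
rewrite -ltnS; apply: leq_trans (leqSpred _) _.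
have := leq_add (lep i) (leq_ (k - i)%N).
by rewrite addSn addnS; case: (_ + _)%N => //= x; rewrite ltnS => /leq_trans->.
Qed.

Lemma inner_deg_le_det N m (M : 'M[{poly {poly R}}]_N) :
  (forall i j, inner_deg_le m (M i j)) -> inner_deg_le (N * m) (\det M).
Proof.
move=> leM; apply: inner_deg_le_sum => s _.
rewrite -[(N * m)%N]add0n; apply: inner_deg_leM => [k|].
  rewrite -signr_odd; case: odd; rewrite ?expr0 ?expr1 ?coefN ?size_polyN;
  by rewrite coef1; case: eqP => _; rewrite ?size_poly1 ?size_poly0.
rewrite -[N in (N * _)%N]card_ord -sum_nat_const.
elim/big_ind2: _ => [k|a p a' p' lep lep'|i _]; last exact: leM.
  by rewrite coef1; case: eqP => _; rewrite ?size_poly1 ?size_poly0.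
exact: inner_deg_leM.
Qed.

(** Substituting x^(s+1) for z is injective in x-degree at most s, since the
    monomials x^l z^j are sent to different monomials. *)
Lemma horner_Xn_eq0 s p :
  inner_deg_le s p -> p.['X^(s.+1)] = 0 -> p = 0.
Proof.
move=> lep p0; apply/polyP=> j0; apply/polyP=> l0; rewrite !coef0.
have [l0s|s_l0] := ltnP l0 s.+1; last first.
  by rewrite nth_default // (leq_trans (lep j0)).
have [j0p|] := ltnP j0 (size p); last by move=> h; rewrite [p`_j0]nth_default ?coef0.
have /(congr1 (fun q : {poly R} => q`_(s.+1 * j0 + l0))) := p0.
rewrite horner_coef coef_sum coef0 (bigD1 (Ordinal j0p)) //= big1 ?addr0 => [E0|j ne_j].
  by rewrite -[RHS]E0 -exprM coefMXn ltnNge leq_addr /= addKn.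
rewrite -exprM coefMXn; case: ltnP => // le_j.
have ltj : (j < j0)%N.
  rewrite ltn_neqAle ne_j /=  -ltnS -(ltn_pmul2l (ltn0Sn s)) (leq_ltn_trans le_j) //.
  by rewrite mulnS addnC ltn_add2r.
rewrite nth_default // (leq_trans (lep j)) //.
have le_s : (s.+1 * j + s.+1 <= s.+1 * j0)%N by rewrite -mulnSr leq_mul2l ltj orbT.
by rewrite leq_subRL // (leq_trans le_s (leq_addr _ _)).
Qed.
End InnerDegree.

Section Independence.
Variables (F : closedFieldType) (I : finType) (b : I -> F) (e : I -> nat).
Variables (d t J K : nat) (k : nat -> nat -> {poly F}).
Hypothesis b_inj : injective b.
Let s := (d * t).+1.
Hypothesis s_char : [pchar F].-nat s.
Hypothesis b_fix : forall i, b i ^+ s = b i.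
Hypothesis d_gt0 : (0 < d)%N.
Hypothesis gcd_e : forall r, (forall i, d %| r * e i)%N -> (d %| r)%N.
Let f := root_prod b e.
Hypothesis size_k : forall i j, (size (k i j) <= K)%N.
Hypothesis s_large : (2 * d * (K + \sum_i e i) < s)%N.

(** Frobenius: f(x)^s = f(x^s), as s is a power of the characteristic and the
    roots of f are fixed by x |-> x^s. *)
Lemma root_prod_exp_s : f ^+ s = f \Po 'X^s.
Proof.
rewrite /f /root_prod -prodrXl rmorph_prod /=; apply: eq_bigr => i _.
rewrite -exprM mulnC exprM rmorphXn /=; congr (_ ^+ _).
rewrite exprDn_pchar; last first.
  by rewrite (eq_pnat _ (pchar_poly _)).
by rewrite exprNn_pchar ?(eq_pnat _ (pchar_poly _)) // -rmorphXn /= b_fix comp_polyB comp_polyX comp_polyC.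
Qed.

(** With s = d t + 1, the power f^t satisfies f(x) (f^t)^d = f(x^s): it is a root
    of B = f(x) Y^d - f(z) after the substitution z = x^s.  A relation of the
    stated form says that it is also a root of the polynomial A in Y with
    coefficients in F[x, z] that is read off from the k i j.  Then the resultant
    of A and B in Y vanishes at z = x^s, hence vanishes identically because its
    x-degree is less than s.  So A and B have a common factor, and so they do
    for a generic value x0 of x, which contradicts [binomial_coprime]. *)
Lemma powers_independent :
    \sum_(i < d) f ^+ (i * t) * \sum_(j < J) k i j * 'X^(s * j) = 0 ->
  forall i j, (i < d)%N -> (j < J)%N -> k i j = 0.
Proof.
move=> rel0.
pose a i : {poly {poly F}} := \poly_(j < J) k i j.
pose A : {poly {poly {poly F}}} := \poly_(i < d) a i.
have innerA i : inner_deg_le K A`_i.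
  move=> j; rewrite coef_poly; case: ifP => _; last by rewrite coef0 size_poly0.
  rewrite coef_poly; case: ifP => _; last by rewrite size_poly0.
  exact: leq_trans (size_k _ _) (leqnSn _).
suff A0 : A = 0.
  move=> i j ltid ltjJ; have /(congr1 (fun p : {poly {poly {poly F}}} => p`_i`_j)) := A0.
  by rewrite coef_poly ltid coef_poly ltjJ !coef0.
(* The value of Y: the element f^t, constant in z. *)
pose Y0 : {poly {poly F}} := (f ^+ t)%:P.
have evalA : A.[Y0].['X^s] = 0.
  rewrite -[RHS]rel0 horner_poly horner_sum; apply: eq_bigr => i _.
  rewrite hornerM horner_exp hornerC mulrC -exprM mulnC; congr (_ * _).
  by rewrite horner_poly; apply: eq_bigr => j _; rewrite exprM.
apply/eqP/negPn/negP=> nzA.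
have szA : (size A <= d)%N by apply: size_poly.
(* If Y does not occur in A there is no resultant to take. *)
have [szA1|szA1] := leqP (size A) 1.
  move: nzA evalA; rewrite (size1_polyC szA1) hornerC polyC_eq0 => /eqP nz0 /horner_Xn_eq0 ev0.
  apply: nz0; apply: ev0 => j; apply: leq_trans (innerA 0 j) _.
  rewrite ltnS; apply: leq_trans (leq_addr (\sum_i e i) K) _.
  rewrite -ltnS; apply: leq_ltn_trans s_large.
  by rewrite leq_pmull // muln_gt0.
pose B : {poly {poly {poly F}}} := f%:P *: 'X^d - (map_poly polyC f)%:P.
have nz_f : f != 0 := root_prod_neq0 b e.
have szX : size (f%:P *: 'X^d : {poly {poly {poly F}}}) = d.+1.
  by rewrite size_scale ?polyC_eq0 // size_polyXn.
have szB : size B = d.+1.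
  rewrite size_polyDl // szX size_polyN size_polyC.
  by apply: leq_ltn_trans (leq_b1 _) _.
have leadB : lead_coef B = f%:P.
  rewrite lead_coefDl ?lead_coefZ ?lead_coefXn ?mulr1 // szX size_polyN size_polyC.
  by apply: leq_ltn_trans (leq_b1 _) _.
have evalB : B.[Y0].['X^s] = 0.
  rewrite hornerD hornerZ hornerXn hornerN hornerC hornerD hornerN hornerM hornerC.
  rewrite /Y0 -rmorphXn /= hornerC -exprM mulnC -exprS root_prod_exp_s.
  by rewrite /comp_poly subrr.
have innerB i : inner_deg_le (\sum_i e i) B`_i.
  have innerC (c : F) : (size c%:P <= (\sum_i e i).+1)%N.
    by rewrite size_polyC; apply: leq_trans (leq_b1 _) _.
  move=> j; rewrite coefB coefZ coefXn coefC; case: eqP => _; case: eqP => _.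
  - rewrite mulr1 coefB coefC coef_map.
    rewrite (leq_trans (size_polyD _ _)) // geq_max size_polyN innerC.
    case: eqP => _; last by rewrite size_poly0.
    by rewrite size_root_prod leqnn.
  - rewrite mulr1 subr0 coefC.
    case: eqP => _; last by rewrite size_poly0.
    by rewrite size_root_prod leqnn.
  - by rewrite mulr0 sub0r coefN size_polyN coef_map innerC.
  - by rewrite mulr0 subr0 coef0 size_poly0.
have res0 : resultant A B = 0.
  have szB1 : (1 < size B)%N by rewrite szB.
  apply: (@horner_Xn_eq0 _ (d * t)); last first.
    have [uv _ /(congr1 (fun p => p.[Y0].['X^s]))] := resultant_in_ideal szA1 szB1.
    rewrite hornerC => ->.
    by rewrite hornerD !hornerM hornerD !hornerM evalA evalB !mulr0 addr0.
  have innerS i j : inner_deg_le (K + \sum_i e i) (Sylvester_mx A B i j).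
    move=> l; rewrite Sylvester_mxE; case: split => h; case: (_ <= j)%N;
      rewrite ?mulr1n ?mulr0n ?coef0 ?size_poly0 //.
      by apply: leq_trans (innerA _ _) _; rewrite ltnS leq_addr.
    by apply: leq_trans (innerB _ _) _; rewrite ltnS leq_addl.
  move=> l; apply: leq_trans (inner_deg_le_det innerS l) _.
  apply: leq_trans s_large; rewrite ltnS leq_mul2r; apply/orP; right.
  by rewrite szB mul2n -addnn leq_add2l (leq_trans (leq_pred _) szA).
(* A value of x at which neither leading coefficient in Y degenerates. *)
have [x0 nz_x0] : exists x0, ~~ root (f * lead_coef (lead_coef A)) x0.
  by apply/closed_nonrootP; rewrite mulf_neq0 // !lead_coef_eq0.
move: nz_x0; rewrite rootM negb_or => /andP[nz_fx0 nz_Ax0].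
pose sigma : {rmorphism {poly {poly F}} -> {fraction {poly F}}} :=
  (@tofrac {poly F} \o map_poly (horner_eval x0))%FUN.
have sA : sigma (lead_coef A) != 0.
  rewrite /= tofrac_eq0; apply: contra nz_Ax0 => /eqP/polyP/(_ (size (lead_coef A)).-1).
  by rewrite coef_map coef0 /= => h; rewrite rootE lead_coefE -[X in X == _]/(horner_eval x0 _) h.
have sB : sigma (lead_coef B) != 0.
  by rewrite leadB /= map_polyC tofrac_eq0 polyC_eq0.
have := map_resultant sA sB; rewrite res0 rmorph0 => /esym/eqP; rewrite resultant_eq0.
have -> : map_poly sigma B = tofrac f.[x0]%:P *: ('X^d - (tofrac ((f.[x0])^-1 *: f))%:P).
  rewrite /B rmorphB /= map_polyZ map_polyXn map_polyC scalerBr; congr (_ *: _ - _).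
    by rewrite /= map_polyC.
  rewrite -mul_polyC -polyCM -tofracM; congr (tofrac _)%:P.
  rewrite mul_polyC scalerA mulfV // scale1r /=.
  by rewrite -map_poly_comp map_poly_id // => c _; rewrite /= /horner_eval hornerC.
have ssA : size (map_poly sigma A) = size A := size_map_poly_id0 sA.
have nzsA : map_poly sigma A != 0 by rewrite -size_poly_gt0 ssA ltnW.
have szsA : (size (map_poly sigma A) <= d)%N by rewrite ssA.
have nz_c : f.[x0]^-1 != 0 by rewrite invr_eq0.
have := binomial_coprime b_inj nz_c gcd_e nzsA szsA.
rewrite -(@coprimepZr _ (tofrac f.[x0]%:P)) ?tofrac_eq0 ?polyC_eq0 //.
by move/eqP ->.
Qed.
End Independence.

(** * Stepanov's method *)

Section Stepanov.
Variables (F : closedFieldType) (I : finType) (b : I -> F) (e : I -> nat).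
Variables (d t : nat).
Hypothesis b_inj : injective b.
Let s := (d * t).+1.
Hypothesis s_char : [pchar F].-nat s.
Hypothesis b_fix : forall i, b i ^+ s = b i.
Hypothesis d_gt0 : (0 < d)%N.
Hypothesis gcd_e : forall r, (forall i, d %| r * e i)%N -> (d %| r)%N.
Let f := root_prod b e.
Let D := (\sum_i e i)%N.

Lemma sum_exp_pchar (J : Type) (r : seq J) (P : pred J) (G : J -> F) :
  (\sum_(i <- r | P i) G i) ^+ s = \sum_(i <- r | P i) G i ^+ s.
Proof.
apply: (big_morph (fun x => x ^+ s)) => [x y|]; first exact: exprDn_pchar.
by rewrite expr0n.
Qed.

Lemma size_root_prodX n : size (f ^+ n) = (D * n).+1.
Proof.
have nz : f ^+ n != 0 by rewrite expf_neq0 ?root_prod_neq0.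
by rewrite -[LHS]prednK ?size_poly_gt0 // size_exp size_root_prod.
Qed.

Lemma exp_surjective (x : F) : exists c, c ^+ s = x.
Proof.
have [c] : exists c, root ('X^s - x%:P) c.
  by apply/closed_rootP; rewrite size_XnsubC.
by rewrite /root !hornerE subr_eq0 => /eqP; exists c.
Qed.

(** Consider R = sum c_ijl x^l f^(i t) x^(s j).  At a point x with x^(s^2) = x and
    f(x)^(t (s + 1)) = zeta, its s-th power times f(x)^((d - 1) t) equals
      sum c_ijl^s zeta^i x^(l s + j) f(x)^((d - 1 - i) t),
    in which x^(s^2) has been replaced by x and f^(i t s) by zeta^i f^(-i t).  This
    is a polynomial of degree about s K, while there are d J K coefficients; with
    J slightly larger than s / d it can be made identically zero.  Then R vanishes
    at all the points in question, so their number is at most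
    deg R = s^2 / d + O(s); and R is not zero by [powers_independent].  As
    everything is an s-th power, no derivatives are involved. *)
Lemma stepanov_bound (zeta : F) (xs : seq F) :
    (4 * d * (8 * D + 3) <= s)%N -> uniq xs -> zeta != 0 ->
    (forall x, x \in xs -> x ^+ (s * s) = x /\ f.[x] ^+ (t * s.+1) = zeta) ->
  (d * size xs <= s * s + d * (9 * D + 3) * s)%N.
Proof.
move=> s_large xs_uniq nz_zeta xsP.
(* K is of the order of s / 4d, so that [powers_independent] applies; the excess w
   of J over t = (s - 1) / d pays for the terms D s and J in the degree of the
   polynomial that has to be cancelled. *)
pose w := (8 * D + 3)%N; pose K := (s %/ (4 * d))%N; pose J := (t + w)%N.
have d4_gt0 : (0 < 4 * d)%N by rewrite muln_gt0.
have wK : (w <= K)%N by rewrite leq_divRL // mulnC.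
have KsU : (4 * d * K <= s)%N by rewrite mulnC leq_trunc_div.
have KsL : (s <= 8 * d * K)%N.
  apply: ltnW; apply: leq_trans (ltn_ceil s d4_gt0) _; rewrite -/K.
  have: (1 <= K)%N by apply: leq_trans wK; rewrite /w addn3.
  by rewrite mulnC -(leq_pmul2l d4_gt0); nia.
pose T : finType := ('I_d * 'I_J * 'I_K)%type.
pose P (u : T) : {poly F} :=
  zeta ^+ u.1.1 *: ('X^(u.2 * s + u.1.2) * f ^+ ((d - u.1.1.+1) * t)).
have [||ee [u0 nz_u0] rel_ee] := @nontrivial_relation F T P (K.-1 * s + J + D * s)%N.
- move=> [[i j] l]; rewrite /P /=; apply: leq_trans (size_scale_leq _ _) _.
  apply: leq_trans (size_polyMleq _ _) _.
  rewrite size_polyXn size_root_prodX addSn addnS /=.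
  have le1 : (l * s <= K.-1 * s)%N by rewrite leq_mul2r; have := ltn_ord l; lia.
  have le2 : (D * ((d - i.+1) * t) <= D * s)%N.
    by rewrite leq_mul2l; apply/orP; right; rewrite /s; nia.
  by have := ltn_ord j; lia.
- rewrite !card_prod !card_ord.
  have K_gt0 : (0 < K)%N by apply: leq_trans wK; rewrite /w addn3.
  have -> : (d * J * K = (s - 1) * K + d * w * K)%N by rewrite /J /s subn1; nia.
  have e1 : (K.-1 * s = s * K - s)%N by case: (K) K_gt0 => // K' _; rewrite mulnS mulnC addKn.
  have e2 : (s <= s * K)%N by rewrite leq_pmulr.
  have e3 : (D * s <= 8 * d * K * D)%N by rewrite mulnC leq_mul2r KsL orbT.
  have e4 : (d * w * K = 8 * d * K * D + 3 * (d * K))%N by rewrite /w; nia.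
  have e5 : (K <= d * K)%N by rewrite leq_pmull.
  have e6 : (t < s)%N by rewrite /s; nia.
  have e7 : ((s - 1) * K = s * K - K)%N by rewrite mulnBl mul1n.
  have e8 : (K <= s * K)%N by rewrite leq_pmull.
  by rewrite e1 e7 e4 /J; lia.
(* The conditions are linear in the s-th powers of the coefficients. *)
have [c cE] : exists c : T -> F, forall u, c u ^+ s = ee u.
  by have [c] := fin_all_exists (fun u => exp_surjective (ee u)); exists c.
pose cn i j l := if insub i is Some i' then
    if insub j is Some j' then
    if insub l is Some l' then c (i', j', l') else 0 else 0 else 0.
pose k i j : {poly F} := \poly_(l < K) cn i j l.
have cnE (i : 'I_d) (j : 'I_J) (l : 'I_K) : cn i j l = c (i, j, l).
  by rewrite /cn !valK.
pose R := \sum_(i < d) f ^+ (i * t) * \sum_(j < J) k i j * 'X^(s * j).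
have nzR : R != 0.
  apply: contra nz_u0 => /eqP R0.
  have k0 : k u0.1.1 u0.1.2 = 0.
    apply: (@powers_independent _ _ _ _ d t J K k b_inj s_char b_fix d_gt0 gcd_e _ _ R0) => //.
      by move=> i j; apply: size_poly.
    rewrite -/D; apply: leq_ltn_trans (_ : 2 * d * K + 2 * d * D < s)%N; first by lia.
    have : (2 * (4 * d * D) + 12 * d <= s)%N by apply: leq_trans s_large; lia.
    by lia.
  rewrite -cE; move/polyP/(_ u0.2): k0.
  by rewrite coef_poly ltn_ord cnE coef0 -!surjective_pairing => ->; rewrite expr0n.
have rootR : all (root R) xs.
  apply/allP=> x xs_x; have [xss fx] := xsP x xs_x.
  have nz_fx : f.[x] != 0.
    apply: contra nz_zeta => /eqP fx0; rewrite -fx fx0 expr0n muln_eq0 orbF.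
    by case: (t =P 0%N) s_large => // t0; rewrite /s t0; lia.
  suff: R.[x] ^+ s * f.[x] ^+ ((d - 1) * t) = (\sum_u ee u *: P u).[x].
    rewrite rel_ee horner0 => /eqP; rewrite mulf_eq0 [X in _ || X](negPf (expf_neq0 _ nz_fx)).
    by rewrite orbF expf_eq0 /=.
  have RxE : R.[x] ^+ s = \sum_(i < d) \sum_(j < J) \sum_(l < K)
      ee (i, j, l) * x ^+ (l * s + j) * f.[x] ^+ (i * t * s).
    rewrite /R horner_sum sum_exp_pchar; apply: eq_bigr => i _.
    rewrite hornerM exprMn horner_exp -exprM horner_sum sum_exp_pchar mulr_sumr.
    apply: eq_bigr => j _; rewrite hornerM horner_poly exprMn sum_exp_pchar.
    rewrite mulrC -mulrA mulr_suml; apply: eq_bigr => l _.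
    have xsE : x ^+ (s * j) ^+ s = x ^+ j by rewrite -exprM mulnAC exprM xss.
    by rewrite exprMn cnE cE hornerXn xsE -exprM exprD !mulrA.
  rewrite RxE pair_bigA /= pair_bigA /= mulr_suml horner_sum.
  apply: eq_bigr => -[[i j] l] _ /=.
  rewrite /P /= !hornerZ hornerM !horner_exp hornerX -!mulrA; congr (_ * _).
  rewrite [RHS]mulrCA; congr (_ * _); rewrite -exprD.
  have -> : (i * t * s + (d - 1) * t = t * s.+1 * i + (d - i.+1) * t)%N.
    have -> : (d - 1 = (d - i.+1) + i)%N by have := ltn_ord i; lia.
    by lia.
  by rewrite exprD exprM fx.
have := max_poly_roots nzR rootR xs_uniq.
have szR : (size R <= K + D * (d * t) + s * J.-1)%N.
  have szsum (n m : nat) (G : nat -> {poly F}) :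
      (forall i, (i < n)%N -> (size (G i) <= m)%N) -> (size (\sum_(i < n) G i)%R <= m)%N.
    move=> leG; apply: leq_trans (size_sum _ _ _) _; apply/bigmax_leqP => i _.
    exact: leG.
  apply: (szsum _ _ (fun i => f ^+ (i * t) * \sum_(j < J) k i j * 'X^(s * j))) => i ltid.
  apply: leq_trans (size_polyMleq _ _) _; rewrite size_root_prodX addSn /=.
  rewrite [(K + _)%N]addnC -addnA; apply: leq_add.
    by rewrite leq_mul2l leq_mul2r ltnW ?orbT.
  apply: (szsum _ _ (fun j => k i j * 'X^(s * j))) => j ltjJ.
  apply: leq_trans (size_polyMleq _ _) _; rewrite size_polyXn addnS /=.
  apply: leq_add; first exact: size_poly.
  by rewrite leq_mul2l; apply/orP; right; lia.
move=> /leq_trans-/(_ _ szR).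
have e1 : (d * (D * (d * t)) <= d * D * s)%N by rewrite mulnA leq_mul2l leqnSn orbT.
have e2 : (d * (s * J.-1) <= s * s + d * s * (8 * D + 2))%N.
  rewrite [(s * J.-1)%N]mulnC; have -> : (J.-1 = t + (8 * D + 2))%N by rewrite /J /w; lia.
  rewrite mulnDl mulnDr; apply: leq_add; first by rewrite mulnA leq_mul2r /s leqnSn orbT.
  by rewrite -mulnA [X in (_ <= _ * X)%N]mulnC.
have e3 : (d * K <= s)%N by apply: leq_trans KsU; lia.
move=> h; have {h} : (d * size xs <= d * K + d * (D * (d * t)) + d * (s * J.-1))%N.
  by rewrite -!mulnDr leq_mul2l ltnW ?orbT.
move/leq_trans; apply.
have e4 : (s <= d * s)%N by rewrite leq_pmull.
have e5 : (d * (9 * D + 3) * s = d * D * s + d * s * (8 * D + 2) + d * s)%N by ring.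
rewrite e5; lia.
Qed.
End Stepanov.

(** * Power sums, Newton's identity and the size of inverse roots *)

Lemma bernoulli_ineq (R : numDomainType) (x : R) n :
  0 <= x -> 1 + x *+ n <= (1 + x) ^+ n.
Proof.
move=> x_ge0; elim: n => [|n IHn]; first by rewrite mulr0n addr0 expr0.
rewrite exprS; apply: le_trans (ler_wpM2l _ IHn); last by rewrite addr_ge0.
rewrite mulrDl mul1r mulrDr mulr1 mulrSr !addrA lerDl.
by rewrite mulr_ge0 // mulrn_wge0.
Qed.

Lemma geometric_bounded (C x : algC) n0 :
  0 <= x -> (forall n, (n0 <= n)%N -> x ^+ n <= C) -> x <= 1.
Proof.
move=> x_ge0 xC; have [//|x_gt1] := real_leP (ger0_real x_ge0) (@real1 _).
have y_gt0 : 0 < x - 1 by rewrite subr_gt0.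
have C_ge0 : 0 <= C by apply: le_trans (xC _ (leqnn n0)); rewrite exprn_ge0.
have := archi_boundP (divr_ge0 C_ge0 (ltW y_gt0)).
set N := Num.bound _; rewrite ltr_pdivrMr // => ltCN.
have := xC (n0 + N)%N (leq_addr _ _).
have := bernoulli_ineq (n0 + N) (ltW y_gt0); rewrite [1 + (x - 1)]addrC subrK.
move=> /le_trans h /h {h}; rewrite mulrnDr => leC.
have: C < C; last by rewrite ltxx.
apply: lt_le_trans ltCN _; apply: le_trans leC.
by rewrite mulr_natl addrA lerDr addr_ge0 // mulrn_wge0 // ltW.
Qed.

(** Multiplying by a polynomial p that vanishes at all the other w isolates the
    powers of one w0: up to a nonzero constant, w0^n is a fixed linear combination
    of consecutive power sums, hence O(A^n). *)
Lemma power_sums_bound (ws : seq algC) (C A : algC) n0 : 0 < A ->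
    (forall n, (n0 <= n)%N -> `|\sum_(w <- ws) w ^+ n| <= C * A ^+ n) ->
  forall w, w \in ws -> `|w| <= A.
Proof.
move=> A_gt0 bnd w0 ws_w0.
(* The Lagrange polynomial of w0, not normalized. *)
pose p := \prod_(u <- rem w0 (undup ws)) ('X - u%:P).
have p_w0 : p.[w0] != 0.
  rewrite horner_prod prodf_seq_neq0; apply/allP=> u; rewrite mem_rem_uniq ?undup_uniq //.
  by rewrite inE => /andP[ne_u _] /=; rewrite hornerXsubC subr_eq0 eq_sym.
have p_u u : u \in ws -> u != w0 -> p.[u] = 0.
  move=> ws_u ne_u; apply/rootP; rewrite root_prod_XsubC.
  by rewrite mem_rem_uniq ?undup_uniq // inE ne_u mem_undup.
have sum_p n : \sum_(w <- ws) p.[w] * w ^+ n = (p.[w0] * w0 ^+ n) *+ count_mem w0 ws.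
  rewrite (bigID (pred1 w0)) /= [X in _ + X]big1_seq ?addr0 => [|u /andP[ne_u ws_u]].
    rewrite (eq_bigr (fun=> p.[w0] * w0 ^+ n)) => [|u /eqP->//].
    by rewrite big_const_seq iter_addr_0.
  by rewrite p_u // mul0r.
pose C' := \sum_(l < size p) `|p`_l| * (C * A ^+ l).
have sum_le n : (n0 <= n)%N -> `|\sum_(w <- ws) p.[w] * w ^+ n| <= C' * A ^+ n.
  move=> le_n.
  have -> : \sum_(w <- ws) p.[w] * w ^+ n = \sum_(l < size p) p`_l * \sum_(w <- ws) w ^+ (l + n).
    under eq_bigr => w _ do rewrite horner_coef mulr_suml.
    rewrite exchange_big; apply: eq_bigr => l _ /=; rewrite mulr_sumr.
    by apply: eq_bigr => w _; rewrite exprD mulrA.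
  rewrite mulr_suml; apply: le_trans (ler_norm_sum _ _ _) _; apply: ler_sum => l _.
  rewrite normrM -!mulrA -exprD ler_wpM2l // bnd //.
  exact: leq_trans le_n (leq_addl _ _).
have cnt_gt0 : (0 < count_mem w0 ws)%N by rewrite -has_count has_pred1.
rewrite -[A]mul1r -ler_pdivrMr //.
apply: (@geometric_bounded (C' / `|p.[w0]|) _ n0) => [|n le_n].
  by rewrite divr_ge0 // ltW.
rewrite ler_pdivlMr ?normr_gt0 // expr_div_n mulrAC ler_pdivrMr ?exprn_gt0 //.
apply: le_trans (sum_le n le_n); rewrite sum_p normrMn normrM normrX mulrC.
case: count cnt_gt0 => // m _; rewrite mulrS lerDl mulrn_wge0 //.
by rewrite mulr_ge0 ?exprn_ge0.
Qed.

Section Newton.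
Variable F : fieldType.

(** The identity is proved by adding one factor at a time: the contribution of a
    new root telescopes. *)
Lemma newton_identity (ws : seq F) (L := \prod_(w <- ws) (1 - w *: 'X)) n :
  L`_n.+1 *+ n.+1 = - \sum_(j < n.+1) (\sum_(w <- ws) w ^+ j.+1) * L`_(n - j).
Proof.
rewrite {}/L; elim: ws n => [|a ws IHws] n.
  rewrite big_nil coef1 mul0rn big1 ?oppr0 // => j _.
  by rewrite big_nil mul0r.
rewrite big_cons; set M := \prod_(w <- ws) _ in IHws *.
have coefM0 : ((1 - a *: 'X) * M)`_0 = M`_0.
  by rewrite mulrBl mul1r -scalerAl coefB coefZ coefXM mulr0 subr0.
have coefMS k : ((1 - a *: 'X) * M)`_k.+1 = M`_k.+1 - a * M`_k.
  by rewrite mulrBl mul1r -scalerAl coefB coefZ coefXM.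
set LL := (1 - a *: 'X) * M in coefM0 coefMS *.
have tele k : \sum_(j < k.+1) a ^+ j.+1 * LL`_(k - j) = a * M`_k.
  elim: k => [|k IHk]; first by rewrite big_ord1 subnn coefM0 expr1.
  rewrite big_ord_recl subn0 coefMS expr1 mulrBr.
  have -> : \sum_(i < k.+1) a ^+ (lift ord0 i).+1 * LL`_(k.+1 - lift ord0 i)
          = a * (a * M`_k).
    rewrite -IHk mulr_sumr; apply: eq_bigr => i _.
    by rewrite lift0 exprS mulrA subSS.
  by rewrite subrK.
under eq_bigr => j _ do rewrite big_cons mulrDl.
rewrite big_split /= tele.
have -> : \sum_(j < n.+1) (\sum_(w <- ws) w ^+ j.+1) * LL`_(n - j)
   = - (M`_n.+1 *+ n.+1) + a * M`_n *+ n.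
  rewrite IHws opprK; case: n => [|n].
    by rewrite !big_ord1 subnn coefM0 mulr0n addr0.
  rewrite big_ord_recr [in RHS]big_ord_recr /= subnn coefM0 addrAC; congr (_ + _).
  rewrite -mulrnAr IHws mulrN mulr_sumr -sumrB; apply: eq_bigr => j _.
  by rewrite subSn ?leq_ord // coefMS mulrBr mulrCA.
by rewrite coefMS mulrnBl opprD opprD opprK addrCA mulrSr; ring.
Qed.

End Newton.

Lemma linear_factorization (F : closedFieldType) (L : {poly F}) : L`_0 = 1 ->
  exists2 ws : seq F, (size ws).+1 = size L & L = \prod_(w <- ws) (1 - w *: 'X).
Proof.
move=> L0; have [rs Lrs] := closed_field_poly_normal L.
have nzL : L != 0 by apply: contra_eq_neq L0 => ->; rewrite coef0 eq_sym oner_eq0.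
have nz_rs r : r \in rs -> r != 0.
  move=> rs_r; apply: contra_eq_neq L0 => r0; rewrite -horner_coef0 Lrs hornerZ.
  by rewrite -r0 (rootP _) ?mulr0 1?eq_sym ?oner_eq0 // root_prod_XsubC.
exists [seq r^-1 | r <- rs].
  by rewrite size_map {1}Lrs size_scale ?lead_coef_eq0 // size_prod_XsubC.
have [k Lk] : exists k, L = k *: \prod_(w <- [seq r^-1 | r <- rs]) (1 - w *: 'X).
  exists (lead_coef L * \prod_(r <- rs) - r).
  rewrite {1}Lrs -scalerA; congr (_ *: _).
  rewrite big_map -scaler_prod; apply: eq_big_seq => r /nz_rs nz_r.
  by rewrite scalerBr scalerA mulNr mulfV // scaleN1r opprK addrC scaleNr alg_polyC.
suff k1 : k = 1 by rewrite {1}Lk k1 scale1r.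
rewrite -L0 Lk coefZ -horner_coef0 horner_prod big1 ?mulr1 // => w _.
by rewrite !hornerE subr0.
Qed.

(** A polynomial with constant term 1 and degree less than h has at most h - 1
    inverse roots; the recursion identifies S n with minus their n-th power sum.
    The values at even indices control the squares of the inverse roots. *)
Lemma first_power_sum_bound (c S : nat -> algC) h (q C : algC) n0 :
    c 0 = 1 -> (forall n, (h <= n)%N -> c n = 0) ->
    (forall n, c n.+1 *+ n.+1 = \sum_(j < n.+1) S j.+1 * c (n - j)%N) ->
    0 < q -> (forall n, (n0 <= n)%N -> `|S (2 * n)%N| <= C * q ^+ n) ->
  `|S 1| <= (h.-1)%:R * sqrtC q.
Proof.
move=> c0 c_h cS q_gt0 bndS.
have [|ws szws Lws] := @linear_factorization _ (\poly_(n < h) c n).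
  by rewrite coef_poly c0; case: ltnP => // /c_h; rewrite c0.
have cE n : (\prod_(w <- ws) (1 - w *: 'X))`_n = c n.
  by rewrite -Lws coef_poly; case: ltnP => // /c_h ->.
have SE n : S n.+1 = - \sum_(w <- ws) w ^+ n.+1.
  elim/ltn_ind: n => n IHn; apply/eqP; rewrite eq_sym -subr_eq0.
  have := newton_identity ws n; rewrite cE cS -sumrN => /eqP.
  rewrite -subr_eq0 -sumrB big_ord_recr /= subnn cE c0 !mulr1 big1 ?add0r => [|j _].
    by move=> SX; rewrite -oppr_eq0 opprB.
  by rewrite cE IHn // mulNr subrr.
have ws_le w : w \in ws -> `|w| <= sqrtC q.
  move=> ws_w; rewrite -(@ler_pXn2r _ 2) ?nnegrE ?sqrtC_ge0 ?(ltW q_gt0) // sqrtCK -normrX.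
  apply: (@power_sums_bound [seq w ^+ 2 | w <- ws] C q (maxn n0 1)) => //; last exact: map_f.
  move=> n; rewrite geq_max => /andP[/bndS le_n n_gt0]; rewrite big_map.
  apply: le_trans le_n; rewrite -[(2 * n)%N]prednK ?muln_gt0 // SE prednK ?muln_gt0 // normrN.
  by under eq_bigr do rewrite -exprM.
rewrite SE normrN; apply: le_trans (ler_norm_sum _ _ _) _.
under eq_bigr do rewrite expr1.
apply: (@le_trans _ _ (\sum_(w <- ws) sqrtC q)); first by rewrite !big_seq ler_sum.
rewrite big_const_seq count_predT iter_addr_0 -(mulr_natl _ (size ws)) ler_wpM2r ?sqrtC_ge0 ?(ltW q_gt0) //.
rewrite ler_nat -ltnS szws; apply: leq_trans (size_poly _ _) _.
by case: (h).
Qed.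

(** * The finite subfields of an algebraic closure *)

Lemma card_finField_pnat (K : finFieldType) : [pchar K].-nat #|K|.
Proof.
have [p p_pr pK] := finPcharP K.
rewrite (eq_pnat _ (pcharf_eq pK)) -cardsT.
exact: (pprimeChar_pgroup pK).
Qed.

Lemma odd_finField_two_neq0 (K : finFieldType) : odd #|K| -> 2%:R != 0 :> K.
Proof.
move=> q_odd; apply/negP=> two0.
have K2 : 2 \in [pchar K] by rewrite inE /= two0.
have := card_finField_pnat K; rewrite (eq_pnat _ (pcharf_eq K2)) => /p_natP[// [|k] qE].
  by have := finNzRing_gt1 K; rewrite qE.
by move: q_odd; rewrite qE expnS oddM.
Qed.

Section FiniteSubfields.
Variables (K : finFieldType) (W : closedFieldType) (emb : {rmorphism K -> W}).
Hypothesis emb_int : integralRange emb.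
Local Notation q := #|K|.
Implicit Types (x y r : W) (n j : nat).

Let q_gt1 : (1 < q)%N.
Proof. exact: finNzRing_gt1. Qed.

Lemma card_exp_pnat n : [pchar W].-nat (q ^ n)%N.
Proof. by rewrite pnatX (eq_pnat _ (fmorph_pchar emb)) card_finField_pnat. Qed.

Lemma frobD n x y : (x + y) ^+ (q ^ n) = x ^+ (q ^ n) + y ^+ (q ^ n).
Proof. by rewrite exprDn_pchar // card_exp_pnat. Qed.

Lemma frob0 n : 0 ^+ (q ^ n) = 0 :> W.
Proof. by rewrite expr0n expn_eq0 -leqn0 leqNgt (ltnW q_gt1). Qed.

Lemma frobN n x : (- x) ^+ (q ^ n) = - x ^+ (q ^ n).
Proof. by rewrite exprNn_pchar // card_exp_pnat. Qed.

Lemma frob_inj n : injective (fun x => x ^+ (q ^ n)).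
Proof.
move=> x y /= /eqP; rewrite -subr_eq0 -frobN -frobD expf_eq0 subr_eq0.
by case/andP=> _ /eqP.
Qed.

Lemma frob_emb n a : emb a ^+ (q ^ n) = emb a.
Proof.
by rewrite -rmorphXn; congr (emb _); elim: n => // n IHn; rewrite expnSr exprM IHn expf_card.
Qed.

Lemma frob_fixed_emb y : y ^+ q = y -> exists a, y = emb a.
Proof.
move=> yq; have := finField_genPoly K; move/(congr1 (map_poly emb)).
rewrite rmorphB /= map_polyXn map_polyX rmorph_prod /= => genP.
have /eqP : (\prod_(x in K) map_poly emb ('X - x%:P)).[y] = 0.
  by rewrite -genP !hornerE yq subrr.
rewrite horner_prod => /prodf_eq0[a _]; rewrite map_polyXsubC hornerXsubC subr_eq0 => /eqP.
by exists a.
Qed.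

(** The subfield with q^n elements, as the list of the roots of X^(q^n) - X. *)
Definition subfield_seq n : seq W := sval (closed_field_poly_normal ('X^(q ^ n) - 'X)).

Lemma subfield_seqE n : (0 < n)%N ->
  'X^(q ^ n) - 'X = \prod_(x <- subfield_seq n) ('X - x%:P).
Proof.
move=> n_gt0; rewrite /subfield_seq; case: closed_field_poly_normal => rs /= {1}->.
have qn_gt1 : (1 < q ^ n)%N by rewrite -{1}(exp1n n) ltn_exp2r ?q_gt1.
by rewrite lead_coefDl ?lead_coefXn ?scale1r // size_polyXn size_polyN size_polyX.
Qed.

Lemma size_subfield_seq n : (0 < n)%N -> size (subfield_seq n) = (q ^ n)%N.
Proof.
move=> n_gt0; apply/eqP; rewrite -eqSS -(size_prod_XsubC _ id) -subfield_seqE //.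
have qn_gt1 : (1 < q ^ n)%N by rewrite -{1}(exp1n n) ltn_exp2r ?q_gt1.
by rewrite size_polyDl size_polyXn // size_polyN size_polyX.
Qed.

Lemma mem_subfield_seq n x : (0 < n)%N -> (x \in subfield_seq n) = (x ^+ (q ^ n) == x).
Proof.
by move=> n_gt0; rewrite -root_prod_XsubC -subfield_seqE // rootE !hornerE subr_eq0.
Qed.

Lemma subfield_seq_uniq n : (0 < n)%N -> uniq (subfield_seq n).
Proof.
move=> n_gt0; rewrite -separable_prod_XsubC -subfield_seqE // unlock derivB derivXn derivX.
have [p p_pr pK] := finPcharP K.
have pW : p \in [pchar {poly W}] by rewrite pchar_poly (fmorph_pchar emb).
have -> : 'X^((q ^ n).-1) *+ (q ^ n) = 0 :> {poly W}.
  rewrite -mulr_natr; have := card_exp_pnat n.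
  rewrite (eq_pnat _ (fun c : nat => esym (pchar_poly W c))) (eq_pnat _ (pcharf_eq pW)).
  case/p_natP=> [[|k] qk]; last by rewrite qk natrX pcharf0 // exprS mul0r mulr0.
  have : (1 < q ^ n)%N by rewrite -{1}(exp1n n) ltn_exp2r ?q_gt1.
  by rewrite qk.
by rewrite sub0r -polyCN -alg_polyC coprimepZr ?oppr_eq0 ?oner_eq0 // coprimep1.
Qed.

Lemma horner_map_frob (p : {poly K}) n r :
  (map_poly emb p).[r ^+ (q ^ n)] = (map_poly emb p).[r] ^+ (q ^ n).
Proof.
rewrite !horner_coef size_map_poly.
rewrite (big_morph (fun x => x ^+ (q ^ n)) (frobD n) (frob0 n)).
by apply: eq_bigr => i _; rewrite coef_map exprMn frob_emb exprAC.
Qed.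

(** The conjugates r^(q^i) are roots of one polynomial over K, so two of them
    coincide. *)
Lemma exists_period r : exists e, (0 < e)%N && (r ^+ (q ^ e) == r).
Proof.
have [p monp rp] := emb_int r.
have rpi i : root (map_poly emb p) (r ^+ (q ^ i)).
  by rewrite rootE horner_map_frob (rootP rp) frob0.
have nzp : map_poly emb p != 0 by rewrite monic_neq0 ?monic_map.
pose rs := [seq r ^+ (q ^ i) | i <- iota 0 (size (map_poly emb p))].
have : ~~ uniq rs.
  apply/negP=> /(max_poly_roots nzp); rewrite size_map size_iota ltnn => h.
  by apply/notF/h/allP=> _ /mapP[i _ ->].
case/(uniqPn 0)=> i [j [ltij]]; rewrite size_map size_iota => ltj.
rewrite !(nth_map 0%N) ?size_iota ?(ltn_trans ltij) // !nth_iota ?(ltn_trans ltij) // !add0n => Eij.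
exists (j - i)%N; rewrite subn_gt0 ltij /=; apply/eqP/(@frob_inj i).
by rewrite -exprM -expnD subnK // ltnW.
Qed.

(** For x in the field with q^j elements this is the characteristic polynomial of x
    over K, a power of its minimal polynomial. *)
Definition norm_poly j x : {poly W} := \prod_(i < j) ('X - (x ^+ (q ^ i))%:P).

Lemma norm_poly_frob j x : x ^+ (q ^ j) = x -> norm_poly j (x ^+ q) = norm_poly j x.
Proof.
rewrite /norm_poly; case: j => [|j]; first by rewrite !big_ord0.
move=> xj; rewrite big_ord_recr [in RHS]big_ord_recl /= expr1 -exprM -expnS xj.
by rewrite mulrC; congr (_ * _); apply: eq_bigr => i _; rewrite -exprM -expnS.
Qed.

Lemma norm_polyD i j x : x ^+ (q ^ i) = x ->
  norm_poly (i + j) x = norm_poly i x * norm_poly j x.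
Proof.
move=> xi; rewrite /norm_poly big_split_ord /=; congr (_ * _).
by apply: eq_bigr => l _; rewrite expnD exprM xi.
Qed.

Lemma norm_poly_monic j x : norm_poly j x \is monic.
Proof. by apply: monic_prod => i _; apply: monicXsubC. Qed.

Lemma size_norm_poly j x : size (norm_poly j x) = j.+1.
Proof. by rewrite /norm_poly -big_enum size_prod_XsubC size_enum_ord. Qed.

Definition descend (y : W) : K := odflt 0 [pick a | emb a == y].

Lemma descendK y : y ^+ q = y -> emb (descend y) = y.
Proof.
move=> /frob_fixed_emb[a ->]; rewrite /descend; case: pickP => [b /eqP // |/(_ a)].
by rewrite eqxx.
Qed.

(** The same polynomial with its coefficients brought back to K. *)
Definition norm_polyK j x : {poly K} := \poly_(i < j.+1) descend (norm_poly j x)`_i.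

Lemma coef_prod_frob j (c : nat -> W) i :
  (\prod_(l < j) ('X - (c l ^+ q)%:P))`_i = ((\prod_(l < j) ('X - (c l)%:P))`_i) ^+ q.
Proof.
have fD x y : (x + y) ^+ q = x ^+ q + y ^+ q by have := frobD 1 x y; rewrite expn1.
have fN x : (- x) ^+ q = - x ^+ q by have := frobN 1 x; rewrite expn1.
have f0 : 0 ^+ q = 0 :> W by have := frob0 1; rewrite expn1.
elim: j i => [|j IHj] i.
  by rewrite !big_ord0 coef1; case: eqP => _; rewrite ?expr1n ?f0.
rewrite !big_ord_recr /= !mulrBr !coefB !coefMX !coefMC fD fN exprMn IHj.
by case: i => [|i] /=; rewrite ?f0 ?IHj.
Qed.

Lemma map_norm_polyK j x : x ^+ (q ^ j) = x -> map_poly emb (norm_polyK j x) = norm_poly j x.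
Proof.
move=> xj; apply/polyP=> i; rewrite coef_map coef_poly.
case: ltnP => [_|le_i]; last first. 
  by rewrite nth_default ?size_norm_poly ?raddf0.
apply: descendK.
rewrite -[in RHS](norm_poly_frob xj) /norm_poly -(coef_prod_frob j (fun l => x ^+ (q ^ l))).
by congr (nth 0 (polyseq _) i); apply: eq_bigr => l _; rewrite exprAC.
Qed.
End FiniteSubfields.

(** * Counting the factors of a polynomial over a finite field *)

Lemma count_andb_split (T : Type) (a b : pred T) (s : seq T) :
  count b s = (count (fun x => a x && b x) s + count (fun x => ~~ a x && b x) s)%N.
Proof. by elim: s => //= x s ->; case: (a x); case: (b x) => /=; lia. Qed.

Lemma count_mem_exchange (T : eqType) (a : pred T) (s t : seq T) :
    uniq s -> uniq t ->
  count (fun x => (x \in t) && a x) s = count (fun x => (x \in s) && a x) t.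
Proof.
move=> Us Ut; rewrite -!size_filter; apply/perm_size/uniq_perm; rewrite ?filter_uniq //.
by move=> x; rewrite !mem_filter; case: (x \in s); case: (x \in t); case: (a x).
Qed.

Section FactorCount.
Variables (K : finFieldType) (W : closedFieldType) (emb : {rmorphism K -> W}).
Hypothesis emb_int : integralRange emb.
Local Notation q := #|K|.
Local Notation normP := (@norm_poly K W).
Local Notation normPK := (@norm_polyK K W emb).
Local Notation subK := (@subfield_seq K W).
Implicit Types (x y r : W) (n j : nat) (g : {poly K}).
Local Notation "g ^emb" := (map_poly emb g) (at level 2, format "g ^emb").

(** The number of pairs (j, x) with j <= n and x in the field with q^j elements
    such that the characteristic polynomial of x divides g. *)
Definition factor_count (g : {poly K}) n :=
  (\sum_(j < n) count (fun x => normP j.+1 x %| g^emb)%R (subK j.+1))%N.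

Lemma conjugates_uniq r e : (forall j, (0 < j < e)%N -> r ^+ (q ^ j) != r) ->
  uniq [seq r ^+ (q ^ i) | i <- iota 0%N e].
Proof.
move=> rmin.
rewrite map_inj_in_uniq ?iota_uniq // => i j; rewrite !mem_iota !add0n /= => lti ltj.
wlog le_ij : i j lti ltj / (i <= j)%N.
  move=> IH Eij; case/orP: (leq_total i j) => le_ij; first exact: IH.
  by symmetry; apply: IH.
move=> Eij; apply/eqP; rewrite eqn_leq le_ij leqNgt; apply/negP=> lt_ij.
have lt0 : (0 < j - i < e)%N by lia.
have /eqP[] := rmin _ lt0; apply: (@frob_inj _ _ emb i).
by rewrite -exprM -expnD subnK.
Qed.

(** Let P = norm_poly e r be the minimal polynomial of r and g = P h.  An x that is
    not conjugate to r counts for g exactly when it counts for h, by coprimality.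
    A conjugate x of r lies in the field of degree j only if e divides j, its
    polynomial at level e + j is P times the one at level j, and so it counts for
    g at level e + j exactly when it counts for h at level j.  The e conjugates at
    level e remain. *)
Lemma factor_count_step g r e (h : {poly K}) n :
    g^emb = normP e r * h^emb -> h \is monic ->
    (0 < e)%N -> r ^+ (q ^ e) = r -> (forall j, (0 < j < e)%N -> r ^+ (q ^ j) != r) ->
    (size h + e <= n.+1)%N ->
  factor_count g n = (factor_count h n + e)%N.
Proof.
move=> gE mon_h e_gt0 re rmin szn.
pose cs := [seq r ^+ (q ^ i) | i <- iota 0%N e].
have csP x : reflect (exists2 i, (i < e)%N & x = r ^+ (q ^ i)) (x \in cs).
  apply: (iffP mapP) => -[i]; last by exists i; rewrite ?mem_iota.
  by rewrite mem_iota add0n => /= lt_ie ->; exists i.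
have cs_frob x : x \in cs -> x ^+ q \in cs.
  case/csP=> i lt_ie ->; rewrite -exprM -expnSr.
  have [lt_i1|] := ltnP i.+1 e; first by apply/csP; exists i.+1.
  move=> le_e; have -> : i.+1 = e by lia.
  by rewrite re; apply/csP; exists 0%N; rewrite ?expn0 ?expr1.
have cs_e x : x \in cs -> x ^+ (q ^ e) = x.
  by case/csP=> i _ ->; rewrite exprAC re.
have cs_norm x : x \in cs -> normP e x = normP e r.
  case/csP=> i _ ->; elim: i => [|i IHi]; first by rewrite expn0 expr1.
  by rewrite expnSr exprM norm_poly_frob // exprAC re.
have cs_min x j : x \in cs -> (0 < j < e)%N -> x ^+ (q ^ j) != x.
  case/csP=> i _ -> ltj; rewrite exprAC; apply: contra_neq (rmin j ltj).
  exact: (@frob_inj _ _ emb).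
have cs_uniq : uniq cs := conjugates_uniq rmin.
have size_cs : size cs = e by rewrite size_map size_iota.
pose cnt (p : {poly K}) j := count (fun x => (x \in cs) && (normP j x %| p^emb)) (subK j).
pose cnt' (p : {poly K}) j := count (fun x => (x \notin cs) && (normP j x %| p^emb)) (subK j).
have fcE p : factor_count p n = (\sum_(j < n) cnt p j.+1 + \sum_(j < n) cnt' p j.+1)%N.
  by rewrite -big_split; apply: eq_bigr => j _; apply: count_andb_split.
have cntcs p j : (0 < j)%N ->
    cnt p j = count (fun x => (x ^+ (q ^ j) == x) && (normP j x %| p^emb)) cs.
  move=> j_gt0; rewrite /cnt count_mem_exchange ?(subfield_seq_uniq emb) //.
  by apply: eq_count => x; rewrite mem_subfield_seq.
have cnt_other j : (0 < j)%N -> cnt' g j = cnt' h j.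
  move=> j_gt0; apply: eq_in_count => x; rewrite mem_subfield_seq // => /eqP xj.
  have [//|cs'x] := boolP (x \in cs); rewrite /= gE Gauss_dvdpr //.
  rewrite coprimep_sym [normP j x]/norm_poly.
  elim/big_ind: _ => [|a b|l _]; first exact: coprimep1.
    by rewrite coprimepMr => -> ->.
  rewrite coprimep_XsubC; apply/negP=> /rootP/eqP; rewrite horner_prod => /prodf_eq0[i _].
  rewrite hornerXsubC subr_eq0 => /eqP xr.
  have cs_xl : x ^+ (q ^ l) \in cs by rewrite xr; apply/csP; exists i.
  have cs_frobn m y : y \in cs -> y ^+ (q ^ m) \in cs.
    by move=> cs_y; elim: m => [|m IHm]; rewrite ?expn0 ?expr1 // expnSr exprM cs_frob.
  have /negP[] := cs'x; rewrite -xj -(subnKC (ltnW (ltn_ord l))) expnD exprM.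
  exact: cs_frobn.
have cnt_lt j : (0 < j < e)%N -> cnt g j = 0%N.
  move=> ltj; rewrite cntcs; last by case/andP: ltj.
  rewrite -(count_pred0 cs); apply: eq_in_count => x cs_x.
  by rewrite (negPf (cs_min x j cs_x ltj)).
have cnt_e : cnt g e = e.
  rewrite cntcs // -[RHS]size_cs; apply/eqP; rewrite -all_count; apply/allP => x cs_x.
  by rewrite cs_e // eqxx cs_norm // gE dvdp_mulr.
have cnt_shift j : (0 < j)%N -> cnt g (e + j) = cnt h j.
  move=> j_gt0; rewrite !cntcs ?addn_gt0 ?e_gt0 //; apply: eq_in_count => x cs_x.
  rewrite expnD exprM cs_e //; congr (_ && _).
  rewrite norm_polyD ?cs_e // cs_norm // gE dvdp_mul2l //.
  by rewrite monic_neq0 ?norm_poly_monic.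
have cnt_big j : (size h <= j)%N -> cnt h j = 0%N.
  move=> szj; rewrite /cnt -(count_pred0 (subK j)); apply: eq_count => x /=.
  apply/negP=> /andP[_ /(dvdp_leq (monic_neq0 (monic_map emb mon_h)))].
  by rewrite size_norm_poly size_map_poly ltnNge szj.
rewrite !fcE; have -> : (\sum_(j < n) cnt' g j.+1 = \sum_(j < n) cnt' h j.+1)%N.
  by apply: eq_bigr => j _; apply: cnt_other.
suff -> : (\sum_(j < n) cnt g j.+1 = \sum_(j < n) cnt h j.+1 + e)%N by rewrite addnAC.
have szh : (0 < size h)%N by rewrite size_poly_gt0 monic_neq0.
have [m nE] : exists m, n = (e + m)%N by exists (n - e)%N; lia.
have -> : \sum_(j < n) cnt g j.+1 = (e + \sum_(j < m) cnt h j.+1)%N.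
  rewrite nE big_split_ord /=; congr (_ + _)%N; last first.
    by apply: eq_bigr => j _; rewrite -addnS cnt_shift.
  have [e' eE] : exists e', e = e'.+1 by exists e.-1; rewrite prednK.
  rewrite eE big_ord_recr /= -eE cnt_e big1 // => j _; apply: cnt_lt.
  by rewrite /= eE ltnS ltn_ord.
rewrite addnC; congr (_ + _)%N; rewrite nE addnC big_split_ord /=.
rewrite [X in _ = (_ + X)%N]big1 ?addn0 // => j _.
by rewrite cnt_big //; lia.
Qed.

(** This is the logarithmic derivative of the Euler product: it expresses the degree
    of g as the sum of the degrees of its irreducible factors. *)
Lemma factor_countE g n : g \is monic -> (size g <= n.+1)%N -> factor_count g n = (size g).-1.
Proof.
have [m] := ubnP (size g); elim: m g => // m IHm g; rewrite ltnS => szg_m mon_g szg_n.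
have szg_gt0 : (0 < size g)%N by rewrite size_poly_gt0 monic_neq0.
have [szg1|szg1] := eqVneq (size g) 1%N.
  rewrite szg1 /factor_count big1 // => j _; rewrite -(count_pred0 (subK j.+1)).
  apply: eq_count => x /=; apply/negP=> /(dvdp_leq (monic_neq0 (monic_map emb mon_g))).
  by rewrite size_norm_poly size_map_poly szg1.
have [r rg] : exists r, root g^emb r.
  by apply/closed_rootP; rewrite size_map_poly.
have /ex_minnP[e /andP[e_gt0 /eqP re] emin] := exists_period emb_int r.
have rmin j : (0 < j < e)%N -> r ^+ (q ^ j) != r.
  case/andP=> j_gt0 lt_je; apply/negP=> rj; have := emin j; rewrite j_gt0 rj => /(_ isT).
  by rewrite leqNgt lt_je.
have dvd_g : normPK e r %| g.
  rewrite -(dvdp_map emb) map_norm_polyK //.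
  rewrite /norm_poly -(big_mkord xpredT (fun i => 'X - (r ^+ (q ^ i))%:P)).
  rewrite -(big_map (fun i => r ^+ (q ^ i)) xpredT (fun x => 'X - x%:P)).
  apply: uniq_roots_dvdp.
    apply/allP=> _ /mapP[i _ ->].
    by rewrite rootE horner_map_frob (rootP rg) frob0.
  rewrite uniq_rootsE /index_iota subn0; exact: conjugates_uniq.
have mon_P : normPK e r \is monic.
  by rewrite -(map_monic emb) map_norm_polyK // norm_poly_monic.
have szP : size (normPK e r) = e.+1.
  by rewrite -(size_map_poly emb) map_norm_polyK // size_norm_poly.
pose h : {poly K} := g %/ normPK e r.
have gh : g = normPK e r * h by rewrite mulrC divpK.
have {h gh} [h gh] : exists h : {poly K}, g = normPK e r * h by exists h.
have mon_h : h \is monic by rewrite -(monicMl _ mon_P) -gh.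
have szh : size g = (e + size h)%N by rewrite gh size_monicM ?monic_neq0 // szP.
have szh_gt0 : (0 < size h)%N by rewrite size_poly_gt0 monic_neq0.
rewrite (@factor_count_step g r e h) //; first 1 last.
- by rewrite [in LHS]gh rmorphM /= map_norm_polyK.
- by rewrite addnC -szh.
rewrite IHm //; first 1 last.
- by lia.
- by lia.
by rewrite szh; lia.
Qed.
End FactorCount.

(** * Multiplicative functions on monic polynomials *)

Section MonicSums.
Variable K : finFieldType.

Definition monic_of n (v : 'rV[K]_n) : {poly K} := 'X^n + rVpoly v.

Lemma size_rVpoly_lt n (v : 'rV[K]_n) : (size (rVpoly v) < size ('X^n : {poly K}))%N.
Proof. by rewrite size_polyXn ltnS; apply: size_poly. Qed.

Lemma monic_of_monic n (v : 'rV[K]_n) : monic_of v \is monic.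
Proof. by rewrite monicE lead_coefDl ?lead_coefXn ?size_rVpoly_lt. Qed.

Lemma size_monic_of n (v : 'rV[K]_n) : size (monic_of v) = n.+1.
Proof. by rewrite /monic_of size_polyDl ?size_rVpoly_lt ?size_polyXn. Qed.

Lemma monic_of_inj n : injective (@monic_of n).
Proof. by move=> u v; rewrite /monic_of => /addrI /(can_inj rVpolyK). Qed.

Lemma monic_ofP n (g : {poly K}) : g \is monic -> size g = n.+1 ->
  monic_of (poly_rV (g - 'X^n) : 'rV_n) = g.
Proof.
move=> /monicP mon_g szg; rewrite /monic_of poly_rV_K; first by rewrite addrC subrK.
apply/leq_sizeP => i; rewrite leq_eqVlt coefB coefXn => /orP[/eqP<-|lt_ni].
  by rewrite eqxx -mon_g lead_coefE szg subrr.
by rewrite nth_default ?szg // gtn_eqF // subrr.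
Qed.

Lemma sum_monic_multiples (V : nmodType) (Phi : {poly K} -> V) (G : {poly K}) j m N :
    G \is monic -> size G = j.+1 -> N = (m + j)%N ->
  \sum_(u : 'rV[K]_m) Phi (G * monic_of u)
    = \sum_(v : 'rV[K]_N | G %| monic_of v) Phi (monic_of v).
Proof.
move=> monG szG NE; have nzG := monic_neq0 monG.
pose mul (u : 'rV[K]_m) : 'rV[K]_N := poly_rV (G * monic_of u - 'X^N).
have mulE u : monic_of (mul u) = G * monic_of u.
  apply: monic_ofP; first by rewrite monicMl // monic_of_monic.
  by rewrite size_monicM ?monic_neq0 ?monic_of_monic // szG size_monic_of NE; lia.
pose quo (v : 'rV[K]_N) : 'rV[K]_m := poly_rV (monic_of v %/ G - 'X^m).
rewrite (reindex_onto mul quo) => [|v dvdG] /=.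
  apply: eq_big => [u|u _]; last by rewrite mulE.
  rewrite mulE dvdp_mulr // /quo mulE mulKp //.
  by apply/esym/eqP/monic_of_inj/monic_ofP; rewrite ?monic_of_monic ?size_monic_of.
apply: monic_of_inj; rewrite mulE /quo.
have quoE : monic_of v = G * (monic_of v %/ G) by rewrite mulrC divpK.
have mon_q : monic_of v %/ G \is monic by rewrite -(monicMl _ monG) -quoE monic_of_monic.
rewrite monic_ofP -?quoE //; have /(congr1 (fun p : {poly K} => size p)) := quoE.
by rewrite size_monicM ?monic_neq0 // szG size_monic_of => szE; move: szE NE; lia.
Qed.

End MonicSums.

Section LFunction.
Variables (K : finFieldType) (W : closedFieldType) (emb : {rmorphism K -> W}).
Hypothesis emb_int : integralRange emb.
Variables (R : comNzRingType) (Phi : {poly K} -> R).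
Hypothesis PhiM : forall g h, g \is monic -> h \is monic -> Phi (g * h) = Phi g * Phi h.

Definition lcoef n : R := \sum_(v : 'rV[K]_n) Phi (monic_of v).
Definition norm_sum j : R := \sum_(x <- subfield_seq K W j) Phi (norm_polyK emb j x).

(** Both sides count, with weight Phi g, the monic g of degree n + 1 together with a
    factor of g that is the characteristic polynomial of some x. *)
Lemma lcoef_newton n :
  lcoef n.+1 *+ n.+1 = \sum_(j < n.+1) norm_sum j.+1 * lcoef (n - j).
Proof.
transitivity (\sum_(j < n.+1) \sum_(x <- subfield_seq K W j.+1)
   \sum_(v : 'rV[K]_n.+1 | norm_polyK emb j.+1 x %| monic_of v) Phi (monic_of v)); last first.
  apply: eq_bigr => j _; rewrite mulr_suml; apply: eq_big_seq => x.
  rewrite mem_subfield_seq // => /eqP xj.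
  have monP : norm_polyK emb j.+1 x \is monic.
    by rewrite -(map_monic emb) map_norm_polyK // norm_poly_monic.
  rewrite mulr_sumr -(@sum_monic_multiples _ _ _ _ j.+1 (n - j)) //.
  - by apply: eq_bigr => u _; rewrite PhiM ?monic_of_monic.
  - by rewrite -(size_map_poly emb) map_norm_polyK // size_norm_poly.
  - by rewrite addnS subnK // -ltnS.
transitivity (\sum_(v : 'rV[K]_n.+1) \sum_(j < n.+1)
    Phi (monic_of v) *+ count (fun x => norm_poly K j.+1 x %| map_poly emb (monic_of v))
                              (subfield_seq K W j.+1)).
  rewrite /lcoef -sumrMnl; apply: eq_bigr => v _; rewrite sumrMnr.
  congr (_ *+ _).
  by rewrite [RHS](factor_countE emb_int (n := n.+1) (monic_of_monic v)) size_monic_of.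
rewrite exchange_big; apply: eq_bigr => j _ /=.
under [RHS]eq_bigr => x _ do rewrite big_mkcond.
rewrite exchange_big; apply: eq_bigr => v _ /=.
rewrite -iter_addr_0 -big_const_seq big_mkcond; apply: eq_big_seq => x.
rewrite mem_subfield_seq // => /eqP xj.
by rewrite -(dvdp_map emb) map_norm_polyK.
Qed.


End LFunction.

(** * Multiplicative characters and their L-polynomials *)

(** The multiplicative group of a finite field is cyclic. *)
Lemma finField_prim_root (K : finFieldType) : {g : K | (#|K|.-1).-primitive_root g}.
Proof.
pose rs := enum [pred x : K | x != 0].
have q_gt1 : (1 < #|K|)%N := finNzRing_gt1 K.
have /hasP/sig2W[g _ gP] : has (#|K|.-1).-primitive_root rs; last by exists g.
apply: has_prim_root; rewrite ?enum_uniq //; first by lia.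
  apply/allP=> x; rewrite mem_enum inE => nz_x; apply/unity_rootP.
  by apply: (mulfI nz_x); rewrite -exprS prednK ?expf_card ?mulr1 // ltnW.
by rewrite -cardE -(cardC1 (0 : K)); apply/eq_leq/eq_card.
Qed.

Lemma prim_root_neq0 (F : fieldType) n (z : F) : n.-primitive_root z -> z != 0.
Proof.
move=> z_prim; have := prim_expr_order z_prim; apply: contra_eq_neq => ->.
by rewrite expr0n eqn0Ngt (prim_order_gt0 z_prim) eq_sym oner_eq0.
Qed.

Lemma norm_prim_root n (z : algC) : n.-primitive_root z -> `|z| = 1.
Proof.
move=> z_prim; apply/eqP; rewrite -(@pexpr_eq1 _ _ n) ?(prim_order_gt0 z_prim) //.
by rewrite -normrX (prim_expr_order z_prim) normr1.
Qed.

Section MultiplicativeCharacter.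
Variables (K : finFieldType) (g : K) (d : nat) (z : algC).
Hypothesis g_prim : (#|K|.-1).-primitive_root g.
Hypothesis d_dvd : (d %| #|K|.-1)%N.
Hypothesis z_prim : d.-primitive_root z.

(** The default value 0 is taken at x = 0 only. *)
Definition dlog (x : K) : nat := odflt 0%N (omap val [pick i : 'I_(#|K|.-1) | g ^+ i == x]).

(** The character with value z at the generator g, extended by 0 at 0. *)
Definition mchar (x : K) : algC := if x == 0 then 0 else z ^+ dlog x.

Lemma dlogK x : x != 0 -> g ^+ dlog x = x.
Proof.
move=> nz_x; have q_gt1 : (1 < #|K|)%N := finNzRing_gt1 K.
have x1 : x ^+ #|K|.-1 = 1.
  by apply: (mulfI nz_x); rewrite -exprS prednK ?expf_card ?mulr1 // ltnW.
have [i ->] := prim_rootP g_prim x1; rewrite /dlog.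
by case: pickP => [j /eqP //|/(_ i)]; rewrite eqxx.
Qed.

Lemma mcharX k : mchar (g ^+ k) = z ^+ k.
Proof.
have nz : g ^+ k != 0 by rewrite expf_neq0 ?(prim_root_neq0 g_prim).
rewrite /mchar (negPf nz); have := dlogK nz => /eqP.
rewrite (eq_prim_root_expr g_prim) => h; apply/eqP.
rewrite (eq_prim_root_expr z_prim); apply/eqP.
by rewrite -(modn_dvdm _ d_dvd) (eqP h) modn_dvdm.
Qed.

Lemma mchar0 : mchar 0 = 0. Proof. by rewrite /mchar eqxx. Qed.

Lemma mchar_eq0 x : (mchar x == 0) = (x == 0).
Proof.
rewrite /mchar; case: (x == 0); rewrite ?eqxx //; apply/negbTE/expf_neq0.
exact: prim_root_neq0 z_prim.
Qed.

Lemma mcharM x y : mchar (x * y) = mchar x * mchar y.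
Proof.
have [->|nz_x] := eqVneq x 0; first by rewrite mul0r mchar0 mul0r.
have [->|nz_y] := eqVneq y 0; first by rewrite mulr0 mchar0 mulr0.
by rewrite -(dlogK nz_x) -(dlogK nz_y) -exprD !mcharX exprD.
Qed.

Lemma mchar1 : mchar 1 = 1.
Proof. by rewrite -(expr0 g) mcharX. Qed.

Lemma mchar_prod (I : Type) (r : seq I) (P : pred I) (F : I -> K) :
  mchar (\prod_(i <- r | P i) F i) = \prod_(i <- r | P i) mchar (F i).
Proof. exact: (big_morph mchar mcharM mchar1). Qed.

Lemma mchar_exp x n : mchar (x ^+ n) = mchar x ^+ n.
Proof. by elim: n => [|n IHn]; rewrite ?mchar1 // !exprS mcharM IHn. Qed.

Lemma mchar_unity x : x != 0 -> mchar x ^+ d = 1.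
Proof.
by rewrite /mchar => /negPf->; rewrite exprAC (prim_expr_order z_prim) expr1n.
Qed.

Lemma sum_mchar_exp k : ~~ (d %| k)%N -> \sum_x mchar x ^+ k = 0.
Proof.
move=> ndk; set S := \sum_x _.
have zS : z ^+ k * S = S.
  rewrite [RHS](reindex_inj (mulfI (prim_root_neq0 g_prim))) mulr_sumr; apply: eq_bigr => x _.
  by rewrite mcharM exprMn -[g]expr1 mcharX expr1.
apply/eqP; have: (z ^+ k - 1) * S == 0 by rewrite mulrBl mul1r zS subrr.
by rewrite mulf_eq0 subr_eq0 -(prim_order_dvd z_prim) (negPf ndk).
Qed.
End MultiplicativeCharacter.

Section WeilBound.
Variables (K : finFieldType) (g : K) (d : nat) (z : algC) (e : K -> nat).
Hypothesis g_prim : (#|K|.-1).-primitive_root g.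
Hypothesis d_dvd : (d %| #|K|.-1)%N.
Hypothesis z_prim : d.-primitive_root z.
Hypothesis e_nontriv : exists b, ~~ (d %| e b)%N.
Local Notation chi := (mchar g z).
Local Notation q := #|K|.

(** The multiplicative function whose value at x - c is, up to the sign of the
    arguments, the product of the chi (c - b) ^ e b. *)
Definition tuple_char (p : {poly K}) : algC := \prod_b chi p.[b] ^+ e b.

Lemma tuple_charM p r : tuple_char (p * r) = tuple_char p * tuple_char r.
Proof.
rewrite -big_split; apply: eq_bigr => b _.
by rewrite hornerM (mcharM g_prim d_dvd z_prim) exprMn.
Qed.

Lemma tuple_char1 : tuple_char 1 = 1.
Proof.
by rewrite /tuple_char big1 // => b _; rewrite hornerC (mchar1 g_prim d_dvd z_prim) expr1n.
Qed.

(** Pick b0 with a nontrivial character and let w vanish at the other relevant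
    points b.  Adding the multiples c w permutes the monic polynomials of degree n,
    does not affect the values at those points, and makes the value at b0 run over
    the whole field; the sum of a nontrivial character is zero. *)
Lemma lcoef_eq0 n : (#|[pred b | e b != 0%N]| <= n)%N -> lcoef tuple_char n = 0.
Proof.
move=> le_n; have [b0 nd_b0] := e_nontriv.
have nz_e0 : e b0 != 0%N by apply: contraNneq nd_b0 => ->; rewrite dvdn0.
pose w : {poly K} := \prod_(b <- enum [predD1 [pred b | e b != 0%N] & b0]) ('X - b%:P).
have szw : (size w <= n)%N.
  rewrite size_prod_XsubC; apply: leq_trans le_n.
  by rewrite -cardE [X in (_ < X)%N](cardD1 b0) inE /= nz_e0.
have w_b0 : w.[b0] != 0.
  by rewrite -[_ == 0]/(root w b0) root_prod_XsubC mem_enum !inE eqxx.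
have w_b b : e b != 0%N -> b != b0 -> w.[b] = 0.
  by move=> nz_b ne_b; apply/rootP; rewrite root_prod_XsubC mem_enum !inE ne_b.
pose sh (c : K) (v : 'rV[K]_n) := v + c *: poly_rV w.
have shE c v : monic_of (sh c v) = monic_of v + c *: w.
  by rewrite /monic_of /sh linearD linearZ /= poly_rV_K // addrA.
have sh_sum c : lcoef tuple_char n = \sum_(v : 'rV[K]_n) tuple_char (monic_of v + c *: w).
  transitivity (\sum_(v : 'rV[K]_n) tuple_char (monic_of (sh c v))).
    exact: (reindex_inj (addIr (c *: poly_rV w))).
  by apply: eq_bigr => v _; rewrite -shE.
have q0 : q%:R != 0 :> algC by rewrite pnatr_eq0 -lt0n (ltnW (finNzRing_gt1 K)).
apply: (mulfI q0); rewrite mulr0.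
transitivity (\sum_(c : K) \sum_(v : 'rV[K]_n) tuple_char (monic_of v + c *: w)).
  by rewrite -(eq_bigr _ (fun c _ => sh_sum c)) sumr_const mulr_natl.
rewrite exchange_big big1 //= => v _.
transitivity ((\prod_(b | b != b0) chi (monic_of v).[b] ^+ e b) *
   \sum_(c : K) chi ((monic_of v).[b0] + c * w.[b0]) ^+ e b0).
  rewrite mulr_sumr; apply: eq_bigr => c _.
  rewrite /tuple_char (bigD1 b0) //= mulrC hornerD hornerZ; congr (_ * _).
  apply: eq_bigr => b ne_b; have [->//|nz_b] := eqVneq (e b) 0%N.
  by rewrite hornerD hornerZ w_b // mulr0 addr0.
have := sum_mchar_exp g_prim d_dvd z_prim nd_b0.
rewrite (reindex_inj (addrI (monic_of v).[b0])) (reindex_inj (mulIf w_b0)) => ->.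
by rewrite mulr0.
Qed.

Lemma lcoef0 : lcoef tuple_char 0 = 1.
Proof.
rewrite /lcoef (bigD1 0) //= big1 ?addr0 => [|v]; last by rewrite [v]thinmx0 eqxx.
by rewrite /monic_of linear0 addr0 expr0 tuple_char1.
Qed.

Lemma lcoef1 : lcoef tuple_char 1 = \sum_x \prod_b chi (x + b) ^+ e b.
Proof.
rewrite /lcoef (reindex (fun x : K => x%:M : 'rV_1)) /=; last first.
  exists (fun v : 'rV[K]_1 => v 0 0) => [x _|v _]; first by rewrite mxE eqxx.
  by rewrite -mx11_scalar.
apply: eq_bigr => x _; apply: eq_bigr => b _; congr (chi _ ^+ _).
rewrite /monic_of; have -> : rVpoly (x%:M : 'rV_1) = x%:P.
  apply/polyP=> -[|i]; rewrite coef_rVpoly coefC /=.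
    by case: insubP => [j _ j0|//]; rewrite ord1 mxE eqxx.
  by case: insubP.
by rewrite hornerD hornerXn hornerC addrC.
Qed.

End WeilBound.

(** * The Weil bound *)

Lemma sum_unity_root (F : fieldType) d (w : F) : w ^+ d = 1 ->
  \sum_(a < d) w ^+ a = if w == 1 then d%:R else 0.
Proof.
move=> wd; case: eqP => [->|/eqP w1].
  by under eq_bigr do rewrite expr1n; rewrite sumr_const card_ord.
apply/eqP; have: (w - 1) * \sum_(a < d) w ^+ a == 0 by rewrite -subrX1 wd subrr.
by rewrite mulf_eq0 subr_eq0 (negPf w1).
Qed.

Lemma sum_prim_root (F : fieldType) d (z : F) :
  (1 < d)%N -> d.-primitive_root z -> \sum_(k < d) z ^+ k = 0.
Proof.
move=> d_gt1 z_prim; rewrite sum_unity_root ?(prim_expr_order z_prim) //.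
by rewrite -[z]expr1 -(prim_order_dvd z_prim) dvdn1; case: eqP d_gt1 => // ->.
Qed.

(** An upper bound for each class suffices for a two-sided estimate: the sum of v
    does not change when A is subtracted from all class sizes, and then all terms
    have the same sign. *)
Lemma equidistributed_sum_bound (T : eqType) (rs : seq T) (v : T -> algC) d z A :
    (1 < d)%N -> d.-primitive_root z ->
    {in rs, forall x, v x = 0 \/ v x ^+ d = 1} ->
    (forall k, (count (fun x => v x == z ^+ k) rs)%:R <= A) ->
  `|\sum_(x <- rs) v x| <= A *+ d - (size rs)%:R + (count (fun x => v x == 0) rs)%:R.
Proof.
move=> d_gt1 z_prim v_rs leA.
pose N (k : nat) : algC := (count (fun x => v x == z ^+ k) rs)%:R.
have nz_z k : z ^+ k != 0.
  exact/expf_neq0/(prim_root_neq0 z_prim).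
have NE k : N k = \sum_(x <- rs) (v x == z ^+ k)%:R.
  rewrite /N -sum1_count natr_sum big_mkcond /=.
  by apply: eq_bigr => x _; case: eqP.
have classE x : x \in rs -> v x != 0 -> exists k0 : 'I_d, forall k : 'I_d, (v x == z ^+ k) = (k == k0).
  move=> rs_x nz; have [v0|vd] := v_rs x rs_x; first by rewrite v0 eqxx in nz.
  have [k0 k0E] := prim_rootP z_prim vd; exists k0 => k; rewrite k0E.
  rewrite (eq_prim_root_expr z_prim) !modn_small // eq_sym.
  by apply/eqP/eqP => [/val_inj|->].
have sumv : \sum_(x <- rs) v x = \sum_(k < d) z ^+ k * N k.
  under [RHS]eq_bigr => k _ do rewrite NE mulr_sumr.
  rewrite exchange_big; apply: eq_big_seq => x rs_x /=.
  have [v0|nz_v] := eqVneq (v x) 0.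
    by rewrite big1 ?v0 // => k _; rewrite eq_sym (negPf (nz_z k)) mulr0.
  have [k0 k0E] := classE x rs_x nz_v.
  rewrite (bigD1 k0) //= k0E eqxx mulr1 big1 ?addr0 => [|k ne_k].
    by apply/eqP; rewrite k0E.
  by rewrite k0E (negPf ne_k) mulr0.
have sumN : \sum_(k < d) N k = (size rs)%:R - (count (fun x => v x == 0) rs)%:R.
  under eq_bigr => k _ do rewrite NE.
  apply/eqP; rewrite eq_sym subr_eq -sum1_size -sum1_count !natr_sum.
  rewrite exchange_big [X in _ + X]big_mkcond -big_split; apply/eqP/eq_big_seq => x rs_x /=.
  have [v0|nz_v] := eqVneq (v x) 0.
    by rewrite big1 ?add0r // => k _; rewrite v0 eq_sym (negPf (nz_z k)).
  have [k0 k0E] := classE x rs_x nz_v.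
  rewrite (bigD1 k0) //= k0E eqxx big1 ?addr0 // => k ne_k.
  by rewrite k0E (negPf ne_k).
have -> : \sum_(x <- rs) v x = \sum_(k < d) z ^+ k * (N k - A).
  under [RHS]eq_bigr do rewrite mulrBr.
  by rewrite sumrB -mulr_suml (sum_prim_root d_gt1 z_prim) mul0r subr0.
apply: le_trans (ler_norm_sum _ _ _) _.
have -> : A *+ d - (size rs)%:R + (count (fun x => v x == 0) rs)%:R = \sum_(k < d) (A - N k).
  by rewrite sumrB sumN opprB addrA addrAC big_const_ord iter_addr_0.
apply: ler_sum => k _; rewrite normrM normrX (norm_prim_root z_prim).
by rewrite expr1n mul1r distrC ger0_norm // subr_ge0 leA.
Qed.

Section Weil.
Variables (K : finFieldType) (g : K) (d : nat) (z : algC) (e : K -> nat).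
Hypothesis g_prim : (#|K|.-1).-primitive_root g.
Hypothesis d_dvd : (d %| #|K|.-1)%N.
Hypothesis z_prim : d.-primitive_root z.
Hypothesis d_gt1 : (1 < d)%N.
Hypothesis gcd_e : forall r, (forall b, d %| r * e b)%N -> (d %| r)%N.
Local Notation chi := (mchar g z).
Local Notation q := #|K|.
Local Notation D := (\sum_b e b)%N.

Section NormSum.
Variables (W : closedFieldType) (emb : {rmorphism K -> W}).

(** Over the field with q^(2n) = s^2 elements the value of the character at x is
    determined by f(x)^(t (s + 1)), so [stepanov_bound] bounds each class. *)
Lemma norm_sum_bound : exists C n0, forall n, (n0 <= n)%N ->
  `|norm_sum emb (tuple_char g z e) (2 * n)| <= C * q%:R ^+ n.
Proof.
pose B := (9 * D + 3)%N; have q_gt1 : (1 < q)%N := finNzRing_gt1 K.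
have d_gt0 := ltnW d_gt1.
exists (d * B + D)%:R, (4 * d * (8 * D + 3))%N => n n_large.
have n_gt0 : (0 < n)%N by apply: leq_trans n_large; rewrite muln_gt0; lia.
pose s := (q ^ n)%N; pose m := (q.-1 %/ d)%N.
have dm : (d * m = q.-1)%N by rewrite mulnC divnK.
have s_large : (4 * d * (8 * D + 3) <= s)%N.
  by apply: leq_trans n_large (ltnW (ltn_expl _ q_gt1)).
pose T := (\sum_(i < 2 * n) q ^ i)%N.
pose t := (m * \sum_(i < n) q ^ i)%N.
have sE : (d * t).+1 = s.
  by rewrite /t mulnA dm -predn_exp prednK // expn_gt0 ltnW.
(* Both are (s^2 - 1) / d: the norm to K has exponent T = (s^2 - 1) / (q - 1). *)
have TmE : (T * m = t * s.+1)%N.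
  have e1 : (q.-1 * T = (s * s).-1)%N by rewrite -predn_exp /s mul2n -addnn expnD.
  apply/eqP; rewrite -(eqn_pmul2l d_gt0) mulnCA dm mulnC e1 mulnA -sE; apply/eqP.
  by move: (d * t)%N => u; nia.
pose a x := \prod_b (norm_polyK emb (2 * n) x).[b] ^+ e b.
have chi_a x : tuple_char g z e (norm_polyK emb (2 * n) x) = chi (a x).
  rewrite (mchar_prod g_prim d_dvd z_prim); apply: eq_bigr => b _.
  by rewrite (mchar_exp g_prim d_dvd z_prim).
pose f := root_prod emb e; pose sg : W := (-1) ^+ D.
have emb_a x : x \in subfield_seq K W (2 * n) -> emb (a x) = (sg * f.[x]) ^+ T.
  rewrite mem_subfield_seq ?muln_gt0 // => /eqP xn.
  have normE b : emb (norm_polyK emb (2 * n) x).[b] = (emb b - x) ^+ T.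
    rewrite -horner_map map_norm_polyK // horner_prod expr_sum; apply: eq_bigr => i _.
    by rewrite hornerXsubC (frobD emb) (frobN emb) frob_emb.
  rewrite rmorph_prod /sg expr_sum /f /root_prod horner_prod -big_split /=.
  rewrite -prodrXl; apply: eq_bigr => b _.
  rewrite rmorphXn /= normE horner_exp hornerXsubC -exprMn mulN1r opprB.
  by rewrite exprAC.
pose rs := subfield_seq K W (2 * n).
have a_class x k : x \in rs -> chi (a x) = z ^+ k ->
    f.[x] ^+ (t * s.+1) = sg ^+ (t * s.+1) * emb g ^+ (k * m).
  move=> rs_x chi_k; have nz_a : a x != 0.
    rewrite -(mchar_eq0 g z_prim) chi_k.
    exact/expf_neq0/(prim_root_neq0 z_prim).
  have am : a x ^+ m = g ^+ (k * m).
    rewrite -(dlogK g_prim nz_a) -exprM; apply/eqP; rewrite (eq_prim_root_expr g_prim).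
    rewrite -dm -!muln_modl; apply/eqP; congr (_ * _)%N; apply/eqP.
    by rewrite -(eq_prim_root_expr z_prim) -chi_k /mchar (negPf nz_a).
  have := congr1 emb am; rewrite !rmorphXn /= emb_a // -exprM TmE exprMn => <-.
  by rewrite mulrA -exprMn -expr2 sqrr_sign expr1n mul1r.
rewrite /norm_sum (eq_bigr _ (fun x _ => chi_a x)).
pose A : algC := (s * s + d * B * s)%:R / d%:R.
have d0 : d%:R != 0 :> algC by rewrite pnatr_eq0 -lt0n.
have a_rs : {in rs, forall x, chi (a x) = 0 \/ chi (a x) ^+ d = 1}.
  move=> x _; have [->|nz] := eqVneq (a x) 0; first by left; apply: mchar0.
  by right; apply: mchar_unity.
have leA k : (count (fun x => chi (a x) == z ^+ k) rs)%:R <= A.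
  rewrite ler_pdivlMr ?ltr0n // -natrM ler_nat -size_filter mulnC.
  set xs := filter _ _.
  have nz_zeta : sg ^+ (t * s.+1) * emb g ^+ (k * m) != 0.
    by rewrite mulf_neq0 ?expf_neq0 ?oppr_eq0 ?oner_eq0 ?fmorph_eq0 ?(prim_root_neq0 g_prim).
  rewrite -sE in s_large nz_zeta *.
  apply: (@stepanov_bound W K emb e d t _ _ _ d_gt0 gcd_e _ xs) nz_zeta _ => //.
  - exact: fmorph_inj.
  - by rewrite sE; apply: card_exp_pnat emb n.
  - by move=> b; rewrite sE frob_emb.
  - by rewrite filter_uniq // (subfield_seq_uniq emb) // muln_gt0.
  move=> x; rewrite mem_filter => /andP[/eqP chi_k rs_x].
  rewrite sE (a_class x k) //; split=> //.
  by move: rs_x; rewrite mem_subfield_seq ?muln_gt0 // mul2n -addnn expnD => /eqP.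
have zero_le : (count (fun x => chi (a x) == 0%R) rs <= D)%N.
  rewrite -size_filter; set ys := filter _ _.
  have nz_f : f != 0 := root_prod_neq0 emb e.
  rewrite -ltnS -(size_root_prod emb e); apply: max_poly_roots nz_f _ _; last first.
    by rewrite filter_uniq // (subfield_seq_uniq emb) // muln_gt0.
  apply/allP=> x; rewrite mem_filter (mchar_eq0 g z_prim) => /andP[/eqP a0 rs_x].
  have /eqP := emb_a x rs_x; rewrite a0 rmorph0 eq_sym expf_eq0 mulf_eq0 signr_eq0 /=.
  by case/andP.
apply: le_trans (equidistributed_sum_bound d_gt1 z_prim a_rs leA) _.
rewrite size_subfield_seq ?muln_gt0 //.
have -> : A *+ d = (s * s + d * B * s)%:R by rewrite -(mulr_natr A d) divfK.
have -> : (q ^ (2 * n) = s * s)%N by rewrite /s mul2n -addnn expnD.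
rewrite natrD [X in X + _ <= _]addrAC subrr add0r -natrX -/s -natrM -natrD ler_nat mulnDl leq_add2l.
by rewrite (leq_trans zero_le) // leq_pmulr // expn_gt0 ltnW.
Qed.
End NormSum.

Lemma weil_bound_gcd :
  `|\sum_x \prod_b chi (x + b) ^+ e b| <= (#|[pred b | e b != 0%N]|.-1)%:R * sqrtC q%:R.
Proof.
have e_nontriv : exists b, ~~ (d %| e b)%N.
  apply/existsP; apply: contraLR d_gt1; rewrite negb_exists => /forallP de.
  rewrite -leqNgt; apply: dvdn_leq => //; apply: gcd_e => b.
  by rewrite mul1n; apply/negPn/de.
have [W [emb emb_int]] := countable_algebraic_closure K.
have [C [n0 bnd]] := norm_sum_bound emb.
have newton := lcoef_newton emb_int (fun g h _ _ => tuple_charM e g_prim d_dvd z_prim g h).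
rewrite -lcoef1.
have := newton 0%N; rewrite big_ord1 subnn mulr1n (lcoef0 e g_prim d_dvd z_prim) mulr1 => ->.
apply: (@first_power_sum_bound (lcoef (tuple_char g z e)) (norm_sum emb (tuple_char g z e)) _ q%:R C n0) => //.
- exact: lcoef0 e g_prim d_dvd z_prim.
- by move=> n; apply: (lcoef_eq0 g_prim d_dvd z_prim e_nontriv).
- by rewrite ltr0n; apply: ltnW (finNzRing_gt1 K).
Qed.
End Weil.

(** * Elements with prescribed classes *)

(** If g0 is the greatest common divisor of d and of all the exponents, the
    characters are powers of one of order d / g0, with exponents to which
    [weil_bound_gcd] applies. *)
Lemma weil_bound (K : finFieldType) (g : K) d (z : algC) (e : K -> nat) :
    (#|K|.-1).-primitive_root g -> (d %| #|K|.-1)%N -> d.-primitive_root z ->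
    (exists b, ~~ (d %| e b)%N) ->
  `|\sum_x \prod_b mchar g z (x + b) ^+ e b|
    <= (#|[pred b | e b != 0%N]|.-1)%:R * sqrtC #|K|%:R.
Proof.
move=> g_prim d_dvd z_prim [b0 nd_b0]; have d_gt0 := prim_order_gt0 z_prim.
pose g1 := \big[gcdn/0%N]_b e b; pose g0 := gcdn d g1.
have g0_gt0 : (0 < g0)%N by rewrite gcdn_gt0 d_gt0.
have g0_d : (g0 %| d)%N := dvdn_gcdl d g1.
have g0_e b : (g0 %| e b)%N.
  by apply: dvdn_trans (dvdn_gcdr d g1) _; apply: (dvdn_biggcdP _ _ _ (dvdnn g1)).
pose d' := (d %/ g0)%N; pose e' b := (e b %/ g0)%N.
have dE : d = (d' * g0)%N by rewrite divnK.
have eE b : e b = (g0 * e' b)%N by rewrite mulnC divnK.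
have z'_prim : d'.-primitive_root (z ^+ g0) by have := exp_prim_root z_prim g0; rewrite (gcdn_idPl g0_d).
have charE x n : mchar g z x ^+ (g0 * n) = mchar g (z ^+ g0) x ^+ n.
  rewrite /mchar; case: eqP => _; last by rewrite exprM (exprAC z).
  by rewrite !expr0n muln_eq0 -leqn0 leqNgt g0_gt0.
have d'_gt1 : (1 < d')%N.
  rewrite ltn_neqAle eq_sym divn_gt0 // dvdn_leq // andbT.
  by apply: contraNneq nd_b0 => d'1; rewrite dE d'1 mul1n.
have gcd_e' r : (forall b, d' %| r * e' b)%N -> (d' %| r)%N.
  move=> dr; pose c := gcdn d' r.
  have c_gt0 : (0 < c)%N by rewrite gcdn_gt0 ltnW.
  have k_e b : (d' %/ c %| e' b)%N.
    have cop : coprime (d' %/ c) (r %/ c).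
      by rewrite /coprime -(eqn_pmul2l c_gt0) muln_gcdr muln1 ![(c * _)%N]mulnC !divnK ?dvdn_gcdl ?dvdn_gcdr.
    rewrite -(Gauss_dvdr _ cop) -(dvdn_pmul2l c_gt0) mulnA ![(c * _)%N]mulnC !divnK ?dvdn_gcdl ?dvdn_gcdr //.
  have: (d' %/ c * g0 %| g0)%N.
    rewrite {2}/g0 dvdn_gcd; apply/andP; split.
      by rewrite [X in (_ %| X)%N]dE dvdn_mul // dvdn_div // dvdn_gcdl.
    by apply/dvdn_biggcdP => b _; rewrite eE mulnC dvdn_mul.
  rewrite -[X in (_ %| X)%N]mul1n dvdn_pmul2r // dvdn1 => /eqP k1.
  by rewrite -(divnK (dvdn_gcdl d' r)) -/c k1 mul1n dvdn_gcdr.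
have := weil_bound_gcd g_prim (dvdn_trans _ d_dvd) z'_prim d'_gt1 gcd_e'.
rewrite (@eq_card _ _ [pred b | e b != 0%N]) => [|b]; last first.
  by rewrite !inE eE muln_eq0 -[g0 == _]leqn0 leqNgt g0_gt0.
under eq_bigr => x _ do under eq_bigr => b _ do rewrite -charE -eE.
by apply; rewrite dE dvdn_mulr.
Qed.

(** The generating polynomial of the support sizes is (1 + (d - 1) X)^m. *)
Lemma sum_by_support (R : comNzRingType) (F : nat -> R) m d : (0 < d)%N ->
  \sum_(a : {ffun 'I_m -> 'I_d}) F #|[pred i | a i != 0%N :> nat]|
    = \sum_(h < m.+1) (F h *+ ('C(m, h) * d.-1 ^ h)).
Proof.
move=> d_gt0.
pose P : {poly R} := \sum_(a : {ffun 'I_m -> 'I_d}) 'X^#|[pred i | a i != 0%N :> nat]|.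
have PE : P = (1 + 'X *+ d.-1) ^+ m.
  have -> : P = \sum_(a : {ffun 'I_m -> 'I_d}) \prod_i 'X^(a i != 0%N :> nat).
    by apply: eq_bigr => a _; rewrite prodrXr -sum1_card big_mkcond.
  rewrite -(bigA_distr_bigA (fun _ (j : 'I_d) => 'X^(j != 0%N :> nat))) /=.
  rewrite prodr_const card_ord; congr (_ ^+ _).
  case: (d) d_gt0 => // d' _; rewrite big_ord_recl /= expr0; congr (_ + _).
  by rewrite (eq_bigr (fun=> 'X)) // sumr_const card_ord.
transitivity (\sum_(h < m.+1) P`_h * F h).
  rewrite /P; under [RHS]eq_bigr => h _ do rewrite coef_sum mulr_suml.
  rewrite exchange_big; apply: eq_bigr => a _ /=.
  have lt_m : (#|[pred i | a i != 0%N :> nat]| < m.+1)%N.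
    by rewrite ltnS -[m in (_ <= m)%N]card_ord max_card.
  rewrite (bigD1 (Ordinal lt_m)) //= coefXn eqxx mul1r big1 ?addr0 // => h ne_h.
  rewrite coefXn; case: eqP => [hE|_]; last by rewrite mul0r.
  by case/eqP: ne_h; apply: val_inj.
apply: eq_bigr => h _; rewrite PE exprDn coef_sum.
rewrite (bigD1 h) //= expr1n mul1r exprMn_n coefMn coefMn coefXn eqxx big1 => [|j ne_j].
  by rewrite addr0 -mulrnA mulr_natl mulnC.
rewrite expr1n mul1r exprMn_n !coefMn coefXn.
by case: eqP => [hj|]; [case/eqP: ne_j; apply: val_inj|rewrite !mul0rn].
Qed.

(** The number U of the bound Q(d, m): the sum of h - 1 over all nontrivial m-tuples
    of characters, where h is the number of nontrivial entries.  The term h = 0 is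
    zero because 0.-1 = 0. *)
Definition weil_defect d m : nat := (\sum_(h < m.+1) h.-1 * ('C(m, h) * d.-1 ^ h))%N.

Section PrescribedClasses.
Variables (K : finFieldType) (g : K) (d : nat) (z : algC).
Hypothesis g_prim : (#|K|.-1).-primitive_root g.
Hypothesis d_dvd : (d %| #|K|.-1)%N.
Hypothesis z_prim : d.-primitive_root z.
Local Notation chi := (mchar g z).
Local Notation q := #|K|.

Lemma shifted_sum_bound m (b : 'I_m -> K) (a : 'I_m -> nat) :
    injective b -> (forall i, a i < d)%N -> (exists i, a i != 0%N) ->
  `|\sum_x \prod_i chi (x - b i) ^+ a i| <= (#|[pred i | a i != 0%N]|.-1)%:R * sqrtC q%:R.
Proof.
move=> b_inj lt_a [i0 nz_i0].
pose e c := (\sum_(i | - b i == c) a i)%N.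
have eE i : e (- b i) = a i.
  rewrite /e (big_pred1 i) // => j; apply/eqP/eqP => [/oppr_inj/b_inj //|-> //].
have nd : exists c, ~~ (d %| e c)%N.
  by exists (- b i0); rewrite eE gtnNdvd // lt0n.
have := weil_bound g_prim d_dvd z_prim nd.
under eq_bigr => x _.
  have -> : \prod_c chi (x + c) ^+ e c = \prod_i chi (x - b i) ^+ a i.
    rewrite [RHS](partition_big (fun i => - b i) xpredT) //=.
    apply: eq_bigr => c _; rewrite /e expr_sum; apply: eq_bigr => i /eqP <-.
    by [].
  over.
move/le_trans; apply; rewrite ler_wpM2r ?sqrtC_ge0 ?ler0n // ler_nat.
have -> : #|[pred c | e c != 0%N]| = #|[seq - b i | i in [pred i | a i != 0%N]]|.
  apply: eq_card => c; rewrite inE; apply/idP/imageP => [nz_c|[i]]; last first.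
    by rewrite inE => nz_i ->; rewrite eE.
  have [i /eqP bi nz_i] : exists2 i, - b i == c & a i != 0%N.
    apply/exists_inP; apply: contraR nz_c; rewrite negb_exists_in => /forall_inP a0.
    by rewrite /e big1 // => i /a0; rewrite negbK => /eqP.
  by exists i.
rewrite card_image // => i j /oppr_inj/b_inj //.
Qed.

(** T x is d^m if x is a solution.  Otherwise it is 0, except at the m points b i,
    where it is at most d^(m - 1) because the i-th factor is 1 (the convention
    0^0 = 1 gives the trivial character the value 1 at 0).  Expanding the
    product, the trivial tuple contributes q and the other ones at most U sqrt q in
    total, so that there would be no room without a solution. *)
Lemma prescribed_classes m (b : 'I_m -> K) (k : 'I_m -> nat) :
    injective b ->
    (weil_defect d m)%:R * sqrtC q%:R + (m * d ^ m.-1)%:R < q%:R :> algC ->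
  exists x, forall i, chi (x - b i) = z ^+ k i.
Proof.
move=> b_inj q_large; have d_gt0 := prim_order_gt0 z_prim.
have nz_z n : z ^+ n != 0.
  exact/expf_neq0/(prim_root_neq0 z_prim).
have norm_z n : `|z ^+ n| = 1.
  by rewrite normrX (norm_prim_root z_prim) expr1n.
pose w x i := chi (x - b i) / z ^+ k i.
have wd x i : x != b i -> w x i ^+ d = 1.
  move=> ne; rewrite expr_div_n (mchar_unity g z_prim) ?subr_eq0 //.
  by rewrite exprAC (prim_expr_order z_prim) expr1n divr1.
pose T x := \prod_i \sum_(a < d) w x i ^+ a.
have [/existsP[x /forallP xP]|noX] := boolP [exists x, [forall i, chi (x - b i) == z ^+ k i]].
  by exists x => i; apply/eqP.
suff: q%:R <= (weil_defect d m)%:R * sqrtC q%:R + (m * d ^ m.-1)%:R :> algC.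
  by move=> le_q; have := le_lt_trans le_q q_large; rewrite ltxx.
have T0 x : (forall i, x != b i) -> T x = 0.
  move=> x_b; have /existsPn/(_ x) := noX; rewrite negb_forall => /existsP[i ne_i].
  rewrite /T (bigD1 i) //= sum_unity_root ?wd //.
  by rewrite -[w x i == 1](inj_eq (mulIf (nz_z (k i)))) divfK // mul1r (negPf ne_i) mul0r.
have Tb j : `|T (b j)| <= (d ^ m.-1)%:R.
  have sum0X : \sum_(a < d) 0 ^+ a = 1 :> algC.
    rewrite (bigD1 (Ordinal d_gt0)) //= expr0 big1 ?addr0 // => a ne_a.
    by rewrite expr0n; case: eqP => // a0; case/eqP: ne_a; apply: val_inj.
  rewrite /T (bigD1 j) //= [X in X * _](_ : _ = 1); last first.
    by rewrite /w subrr mchar0 mul0r.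
  have -> : (d ^ m.-1)%:R = \prod_(i : 'I_m | i != j) d%:R :> algC.
    by rewrite prodr_const cardC1 card_ord natrX.
  rewrite mul1r normr_prod; apply: ler_prod => i ne_ij; rewrite normr_ge0 /=.
  rewrite sum_unity_root ?wd ?(inj_eq b_inj) 1?eq_sym //.
  by case: ifP; rewrite ?normr0 ?ler0n // ger0_norm ?ler0n.
have upper : `|\sum_x T x| <= (m * d ^ m.-1)%:R.
  apply: le_trans (ler_norm_sum _ _ _) _.
  have -> : (m * d ^ m.-1)%:R = \sum_x \sum_(i | b i == x) (d ^ m.-1)%:R :> algC.
    rewrite (exchange_big_dep xpredT) //=.
    rewrite (eq_bigr (fun=> (d ^ m.-1)%:R)) => [|i _]; last first.
      by rewrite (big_pred1 (b i)) // => x; rewrite eq_sym.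
    by rewrite sumr_const card_ord natrM mulr_natl.
  apply: ler_sum => x _; have [/existsP[j /eqP <-]|] := boolP [exists j, b j == x].
    by rewrite (bigD1 j) //= ler_wpDr ?Tb // sumr_ge0 // => i _; rewrite ler0n.
  move=> /existsPn noj; rewrite T0 => [|i]; last by rewrite eq_sym noj.
  by rewrite normr0 sumr_ge0 // => i _; rewrite ler0n.
have lower : q%:R <= `|\sum_x T x| + (weil_defect d m)%:R * sqrtC q%:R.
  have TE : \sum_x T x = \sum_(a : {ffun 'I_m -> 'I_d}) (\prod_i (z ^+ k i)^-1 ^+ a i)
      * \sum_x \prod_i chi (x - b i) ^+ a i.
    rewrite /T; under eq_bigr => x _ do rewrite bigA_distr_bigA.
    rewrite exchange_big; apply: eq_bigr => a _ /=; rewrite mulr_sumr; apply: eq_bigr => x _.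
    by rewrite -big_split; apply: eq_bigr => i _; rewrite /w exprMn mulrC.
  pose a0 : {ffun 'I_m -> 'I_d} := [ffun=> Ordinal d_gt0].
  have q_a0 : (\prod_i (z ^+ k i)^-1 ^+ a0 i) * \sum_x \prod_i chi (x - b i) ^+ a0 i = q%:R.
    rewrite big1 ?mul1r => [|i _]; last by rewrite ffunE expr0.
    by rewrite (eq_bigr (fun=> 1)) ?sumr_const // => x _; rewrite big1 // => i _; rewrite ffunE expr0.
  move: TE; rewrite (bigD1 a0) //= q_a0; set rest := (X in _ + X) => TE.
  have qE : q%:R = `|\sum_x T x - rest| by rewrite TE addrK ger0_norm ?ler0n.
  rewrite [X in X <= _]qE; apply: le_trans (ler_normB _ _) _; rewrite lerD2l.
  apply: le_trans (ler_norm_sum _ _ _) _.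
  have -> : (weil_defect d m)%:R * sqrtC q%:R =
      \sum_(a : {ffun 'I_m -> 'I_d}) (#|[pred i | a i != 0%N :> nat]|.-1)%:R * sqrtC q%:R :> algC.
    rewrite -mulr_suml (sum_by_support (fun h => h.-1%:R)) // natr_sum; congr (_ * _).
    by apply: eq_bigr => h _; rewrite natrM mulr_natr.
  have rhs_ge0 (a : {ffun 'I_m -> 'I_d}) : 0 <= (#|[pred i | a i != 0%N :> nat]|.-1)%:R * sqrtC q%:R :> algC.
    by rewrite mulr_ge0 ?sqrtC_ge0 ?ler0n.
  rewrite [X in _ <= X](bigID (predC1 a0)) /= ler_wpDr ?sumr_ge0 //.
  apply: ler_sum => a ne_a; rewrite normrM normr_prod big1 ?mul1r => [|i _]; last first.
    by rewrite normrX normfV norm_z invr1 expr1n.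
  apply: shifted_sum_bound => //; apply/existsP; apply: contraR ne_a.
  rewrite negb_exists => /forallP a_0; apply/eqP/ffunP => i; rewrite ffunE; apply/val_inj/eqP.
  by move: (a_0 i); rewrite negbK.
by rewrite addrC; apply: le_trans lower _; rewrite lerD2r.
Qed.
End PrescribedClasses.

(** * Choosing labels one at a time *)

Lemma Usum_weil_defect (R : rcfType) d m : (0 < d)%N -> Usum R d m = (weil_defect d m)%:R.
Proof.
move=> d_gt0; rewrite /Usum /weil_defect big_ord_recl /= mul0n add0n natr_sum.
rewrite big_add1 /= big_mkord; apply: eq_bigr => h _.
have predE n : (0 < n)%N -> n%:R - 1 = n.-1%:R :> R by case: n => // n _; rewrite -natr1 addrK.
rewrite !predE // -natrX -!natrM; congr (_%:R).
by rewrite /bump leq0n add0n !add1n [LHS]mulnC.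
Qed.

(** Put c = d^(m-1) m.  The bound Q(d, m) is the square of the positive root x of
    x^2 - U x - c, so q > Q(d, m) means q - c > U sqrt q.  Squaring gives an
    inequality between natural numbers, which can be read in any field. *)
Lemma Qbound_weil_defect (R : rcfType) d m q : (0 < d)%N -> Qbound R d m < q%:R ->
  (weil_defect d m)%:R * sqrtC q%:R + (m * d ^ m.-1)%:R < q%:R :> algC.
Proof.
move=> d_gt0; rewrite /Qbound Usum_weil_defect //.
set U := weil_defect d m; set c := (m * d ^ m.-1)%N.
have -> : 4 * d%:R ^+ (m - 1) * m%:R = 4 * c%:R :> R.
  by rewrite /c natrM natrX subn1; ring.
set r := Num.sqrt _ => Qlt.
have r_ge0 : 0 <= r by rewrite sqrtr_ge0.
have r2 : r ^+ 2 = U%:R ^+ 2 + 4 * c%:R.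
  by rewrite sqr_sqrtr // addr_ge0 ?exprn_ge0 // ?mulr_ge0 // ?ler0n.
pose x : R := (U%:R + r) / 2; pose s : R := Num.sqrt q%:R.
have U_ge0 : 0 <= U%:R :> R by rewrite ler0n.
have x_ge0 : 0 <= x by rewrite /x; lra.
have s_ge0 : 0 <= s by rewrite sqrtr_ge0.
have s2 : s ^+ 2 = q%:R by rewrite sqr_sqrtr ?ler0n.
have x_lt_s : x < s.
  rewrite -(@ltr_pXn2r _ 2) // ?nnegrE // s2.
  by apply: le_lt_trans Qlt; rewrite /x; lra.
have Us : U%:R * s < q%:R - c%:R.
  have xE : x ^+ 2 = U%:R * x + c%:R by rewrite /x; nra.
  have h : 0 < (s - x) * (s + x - U%:R).
    by rewrite mulr_gt0 ?subr_gt0 //; rewrite /x in x_lt_s *; lra.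
  by rewrite -s2; nra.
have c_lt_q : (c < q)%N.
  by rewrite -(ltr_nat R) -subr_gt0 (le_lt_trans _ Us) // mulr_ge0.
have sq_lt : (U ^ 2 * q < (q - c) ^ 2)%N.
  rewrite -(ltr_nat R) natrM !natrX natrB ?(ltnW c_lt_q) // -s2 -exprMn.
  rewrite -s2 in Us; rewrite ltr_pXn2r ?nnegrE ?mulr_ge0 //.
  by apply: ltW (le_lt_trans _ Us); rewrite mulr_ge0.
rewrite -ltrBrDr -natrB ?(ltnW c_lt_q) //.
rewrite -(@ltr_pXn2r _ 2) // ?nnegrE ?ler0n ?mulr_ge0 ?sqrtC_ge0 ?ler0n //.
by rewrite exprMn sqrtCK -!natrX -natrM ltr_nat.
Qed.

Lemma weil_defect_mono d m n : (m <= n)%N -> (weil_defect d m <= weil_defect d n)%N.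
Proof.
move=> le_mn; rewrite /weil_defect -!(big_mkord xpredT (fun h => h.-1 * ('C(_, h) * d.-1 ^ h))%N).
rewrite [X in (_ <= X)%N](@big_cat_nat _ _ _ m.+1) //=.
apply: leq_trans (leq_addr _ _); apply: leq_sum => h _.
by rewrite !leq_mul // leq_bin2l.
Qed.

Section Labelling.
Variables (K : finFieldType) (g : K) (p : nat) (z : algC).
Local Notation d := p.+1.
Local Notation q := #|K|.
Hypothesis g_prim : (q.-1).-primitive_root g.
Hypothesis q_mod : (2 * d %| q.-1)%N.
Hypothesis z_prim : d.-primitive_root z.
Hypothesis q_large : (weil_defect d p)%:R * sqrtC q%:R + (p * d ^ p.-1)%:R < q%:R :> algC.
Local Notation chi := (mchar g z).

Let d_dvd : (d %| q.-1)%N.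
Proof. by apply: dvdn_trans q_mod; apply: dvdn_mull. Qed.

(** As 2 d divides q - 1, -1 is a d-th power. *)
Lemma mcharN x : chi (- x) = chi x.
Proof.
rewrite -mulN1r (mcharM g_prim d_dvd z_prim).
suff -> : chi (- 1) = 1 by rewrite mul1r.
have nz1 : -1 != 0 :> K by rewrite oppr_eq0 oner_eq0.
rewrite /mchar (negPf nz1); apply/eqP; rewrite -(prim_order_dvd z_prim).
rewrite -(@dvdn_pmul2l 2) //; apply: dvdn_trans q_mod _.
by rewrite (prim_order_dvd g_prim) mulnC exprM (dlogK g_prim nz1) sqrrN expr1n.
Qed.

Lemma two_neq0 : 2%:R != 0 :> K.
Proof.
apply: odd_finField_two_neq0; have q_gt0 := ltnW (finNzRing_gt1 K).
have := dvdn_trans (dvdn_mulr d (dvdnn 2)) q_mod.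
by rewrite dvdn2 -[in odd q](prednK q_gt0) /= => ->.
Qed.

Lemma prescribed_classes_seq (bk : seq (K * nat)) :
    uniq (unzip1 bk) -> (size bk <= p)%N ->
  exists x, forall b k, (b, k) \in bk -> chi (x - b) = z ^+ k.
Proof.
move=> bk_uniq szbk; pose m := size bk.
have b_inj : injective (fun i : 'I_m => (nth (0, 0%N) bk i).1).
  move=> i j; rewrite -!(nth_map _ 0) // => /eqP.
  by rewrite nth_uniq ?size_map // => /eqP/val_inj.
have [|x xP] := prescribed_classes g_prim d_dvd z_prim (fun i => (nth (0, 0%N) bk i).2) b_inj.
  apply: le_lt_trans q_large; apply: lerD.
    by rewrite ler_wpM2r ?sqrtC_ge0 ?ler0n // ler_nat weil_defect_mono.
  rewrite ler_nat leq_mul // leq_pexp2l //.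
  by rewrite -!subn1 leq_sub2r.
exists x => b k /(nthP (0, 0%N))[i lti Ebk].
by have := xP (Ordinal lti); rewrite /= Ebk.
Qed.

(** The conditions on a new label x for v concern the points 0, l u and - l u, for
    u among the earlier vertices.  They are different points because the labels
    are in different classes, l u and - l u being in the same one, and the
    characteristic is not 2. *)
Lemma labelling (V : eqType) (vs : seq V) (c : V -> nat) (kappa : bool -> V -> V -> nat) :
    uniq vs -> (2 * size vs <= p.+1)%N ->
    {in vs &, injective (fun v => z ^+ c v)} ->
    (forall s u v, kappa s u v = kappa s v u) ->
  exists l : V -> K, {in vs, forall v, chi (l v) = z ^+ c v} /\
    {in vs &, forall u v, u != v ->
       chi (l u - l v) = z ^+ kappa false u v /\ chi (l u + l v) = z ^+ kappa true u v}.
Proof.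
elim: vs => [|v vs IHvs] /=; first by exists (fun=> 0).
case/andP=> vs'v vs_uniq szvs c_inj kC.
have [||//|l [lc lk]] := IHvs vs_uniq.
- by lia.
- by move=> x y vs_x vs_y; apply: c_inj; rewrite inE ?vs_x ?vs_y orbT.
have l_neq0 u : u \in vs -> l u != 0.
  move=> vs_u; rewrite -(mchar_eq0 g z_prim) lc //.
  exact/expf_neq0/(prim_root_neq0 z_prim).
have l_inj u w : u \in vs -> w \in vs -> chi (l u) = chi (l w) -> u = w.
  by move=> vs_u vs_w; rewrite !lc // => /c_inj; apply; rewrite inE ?vs_u ?vs_w orbT.
pose bk := (0, c v) :: [seq (l u, kappa false v u) | u <- vs] ++ [seq (- l u, kappa true v u) | u <- vs].
have [||x xP] := @prescribed_classes_seq bk.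
- rewrite /= /unzip1 map_cat -!map_comp; apply/andP; split.
    rewrite mem_cat negb_or; apply/andP; split; apply/mapP=> -[u /l_neq0] /=.
      by move/eqP=> nz /esym.
    by move/eqP=> nz /esym/eqP; rewrite oppr_eq0 => /eqP.
  rewrite cat_uniq; apply/and3P; split.
  + by rewrite map_inj_in_uniq // => u w vs_u vs_w /= E; apply: l_inj; rewrite ?E.
  + apply/hasPn=> _ /mapP[u vs_u ->]; apply/mapP=> -[w vs_w] /= E.
    have uw : u = w by apply: l_inj => //; rewrite -E mcharN.
    move: E; rewrite uw => /eqP; rewrite eq_sym -addr_eq0 -mulr2n -mulr_natl mulf_eq0.
    by rewrite (negPf two_neq0) (negPf (l_neq0 w vs_w)).
  + by rewrite map_inj_in_uniq // => u w vs_u vs_w /= /oppr_inj E; apply: l_inj; rewrite ?E.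
- by rewrite /= size_cat !size_map; lia.
pose l' u := if u == v then x else l u.
have l'v : l' v = x by rewrite /l' eqxx.
have l'E u : u \in vs -> l' u = l u.
  by rewrite /l'; case: eqP => // -> vs_v; rewrite vs_v in vs'v.
have xv : chi x = z ^+ c v.
  by rewrite -[x]subr0; apply: xP; rewrite inE eqxx.
have x_m u : u \in vs -> chi (x - l u) = z ^+ kappa false v u.
  move=> vs_u; apply: xP; rewrite inE mem_cat; apply/orP; right; apply/orP; left.
  by apply/mapP; exists u.
have x_p u : u \in vs -> chi (x + l u) = z ^+ kappa true v u.
  move=> vs_u; rewrite -[l u]opprK; apply: xP.
  by rewrite inE mem_cat; apply/orP; right; apply/orP; right; apply/mapP; exists u.
exists l'; split=> [u|u w]; rewrite !inE.
  by case/predU1P=> [->|vs_u]; rewrite ?l'v // l'E // lc.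
case/predU1P=> [->|vs_u]; case/predU1P=> [->|vs_w]; rewrite ?eqxx // => ne_uw.
- by rewrite l'v l'E //; split; [apply: x_m|apply: x_p].
- rewrite l'v l'E // kC [kappa true _ _]kC -opprB mcharN [l u + x]addrC.
  by split; [apply: x_m|apply: x_p].
- by rewrite !l'E //; apply: lk.
Qed.
End Labelling.

(** * Squares and nonsquares as a difference family *)

Section PaleyBlocks.
Variables (F : finFieldType) (gF : F).
Hypothesis gF_prim : (#|F|.-1).-primitive_root gF.
Hypothesis F_odd : odd #|F|.
Local Notation p := #|F|.

Lemma prim2_root : 2.-primitive_root (-1 : algC).
Proof.
have ne1 : (-1 == 1 :> algC) = false by rewrite eqNr oner_eq0.
apply/andP; split=> //; apply/forallP=> -[[|[|//]] lti] /=; rewrite unity_rootE.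
  by rewrite expr1 ne1.
by rewrite expr2 mulrNN mulr1 !eqxx.
Qed.

Let two_dvd : (2 %| p.-1)%N.
Proof. by rewrite dvdn2; have := F_odd; case: #|F|. Qed.

Definition qchar : F -> algC := mchar gF (-1).

Lemma qcharM x y : qchar (x * y) = qchar x * qchar y.
Proof. exact: mcharM gF_prim two_dvd prim2_root x y. Qed.

Lemma qchar0 : qchar 0 = 0. Proof. exact: mchar0. Qed.

Lemma qchar_sq x : x != 0 -> qchar x * qchar x = 1.
Proof. by move=> nz_x; rewrite -expr2 (mchar_unity gF prim2_root). Qed.

Lemma qchar_sign x : x != 0 -> exists b : bool, qchar x = (-1) ^+ b.
Proof.
move=> /qchar_sq/eqP; rewrite -expr2 sqrf_eq1 => /orP[]/eqP->; first by exists false.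
by exists true.
Qed.

Lemma sum_qchar : \sum_x qchar x = 0.
Proof.
have nd : ~~ (2 %| 1)%N by [].
have := sum_mchar_exp gF_prim two_dvd prim2_root nd.
by under eq_bigr do rewrite expr1.
Qed.

(** For x <> 0 the summand is qchar (1 + delta / x), and 1 + delta / x takes every
    value except 1. *)
Lemma sum_qchar_shift delta : delta != 0 -> \sum_x qchar x * qchar (x + delta) = -1.
Proof.
move=> nz_d; rewrite (bigD1 0) //= qchar0 mul0r add0r.
have -> : -1 = \sum_(y | y != 0) qchar (1 + y).
  have := sum_qchar; rewrite (reindex_inj (addrI 1)) (bigD1 0) //= addr0.
  have -> : qchar 1 = 1 by apply: mchar1 gF_prim two_dvd prim2_root.
  by move/eqP; rewrite addrC addr_eq0 => /eqP.
rewrite [RHS](reindex_onto (fun x => delta / x) (fun y => delta / y)) /=; last first.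
  by move=> y nz_y; rewrite invf_div mulrCA mulfV // mulr1.
apply: eq_big => [x|x nz_x].
  rewrite mulf_eq0 invr_eq0 (negPf nz_d) /=; case: eqP => //= /eqP nz_x.
  by rewrite invf_div mulrCA mulfV // mulr1 eqxx.
rewrite -[X in _ * qchar X]/(x + delta) -{2}[x]mulr1 -{1}[delta](mulfVK nz_x) [delta / x * x]mulrC -mulrDr.
by rewrite qcharM mulrA qchar_sq // mul1r.
Qed.

(** The squares for beta = true and the nonsquares for beta = false; 0 belongs to
    both sets. *)
Definition paley_block (beta : bool) : {set F} := [set a | qchar a != (-1) ^+ beta].

Lemma paley_indicator beta a :
  (a \in paley_block beta)%:R = (1 - (-1) ^+ beta * qchar a + (a == 0)%:R) / 2 :> algC.
Proof.
rewrite inE; have [->|nz_a] := eqVneq a 0.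
  rewrite qchar0 mulr0 subr0 eq_sym signr_eq0 /= -[1 + 1]/(2%:R) divff //.
  by rewrite pnatr_eq0.
have [b ->] := qchar_sign nz_a; rewrite -signr_addb addr0 (inj_eq (@signr_inj _)).
case: b; case: beta; rewrite /= ?expr0 ?expr1 ?opprK ?subrr ?mul0r ?divff ?pnatr_eq0 //.
all: by rewrite -[1 + 1]/(2%:R : algC) pnatr_eq0.
Qed.

Lemma card_paley_block beta : (2 * #|paley_block beta| = p.+1)%N.
Proof.
apply/eqP; rewrite -(eqr_nat algC) natrM -sum1_card natr_sum big_mkcond /=.
rewrite (eq_bigr (fun a => (1 - (-1) ^+ beta * qchar a + (a == 0)%:R) / 2)) => [|a _]; last first.
  by rewrite -paley_indicator; case: ifP.
rewrite -mulr_suml big_split sumrB -mulr_sumr sum_qchar mulr0 subr0 sumr_const.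
rewrite (bigD1 0) //= eqxx big1 ?addr0 => [|a /negPf-> //].
by rewrite mulrC divfK ?pnatr_eq0 // natr1.
Qed.

(** The third component is a sign: the edge from a to a + delta carries both the
    difference and the sum of the labels of its ends. *)
Definition paley_edges delta : {set bool * F * bool} :=
  [set x | (x.1.2 \in paley_block x.1.1) && (x.1.2 + delta \in paley_block x.1.1)].

(** By [paley_indicator], summing over the two blocks leaves half of
    1 + [a = 0] + [a + delta = 0] + qchar a * qchar (a + delta) for each a. *)
Lemma card_paley_edges delta : delta != 0 -> #|paley_edges delta| = p.+1.
Proof.
move=> nz_d; apply/eqP; rewrite -(eqr_nat algC) -sum1_card natr_sum big_mkcond /=.
pose G (beta : bool) a : algC := (a \in paley_block beta)%:R * (a + delta \in paley_block beta)%:R.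
have -> : \sum_x (if x \in paley_edges delta then 1%:R else 0) =
    \sum_a \sum_(beta : bool) \sum_(eps : bool) G beta a :> algC.
  rewrite exchange_big pair_bigA /= pair_bigA /=; apply: eq_bigr => -[[beta a] eps] _ /=.
  by rewrite inE /G /=; case: (a \in _); rewrite ?mul0r //= mul1r; case: ifP.
have -> : \sum_a \sum_(beta : bool) \sum_(eps : bool) G beta a =
    \sum_a (1 + (a == 0)%:R + (a + delta == 0)%:R + qchar a * qchar (a + delta)).
  apply: eq_bigr => a _; rewrite !big_bool /= /G !paley_indicator expr0 expr1.
  have e0 : (a == 0)%:R * (a + delta == 0)%:R = 0 :> algC.
    by case: eqP => [->|]; rewrite ?mul0r // add0r (negPf nz_d) mulr0.
  transitivity (1 + (a == 0)%:R + (a + delta == 0)%:R + (a == 0)%:R * (a + delta == 0)%:R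
      + qchar a * qchar (a + delta)); last by rewrite e0 addr0.
  by move: (a == 0)%:R (a + delta == 0)%:R => x y; field.
rewrite !big_split /= sumr_const sum_qchar_shift // (bigD1 0) //= eqxx big1 ?addr0 => [|a /negPf-> //].
rewrite [X in _ + X - 1](bigD1 (- delta)) //= addNr eqxx big1 ?addr0 => [|a ne_a].
  by rewrite addrK natr1.
by rewrite addr_eq0 (negPf ne_a).
Qed.
End PaleyBlocks.

(** * Labels for the squares and the nonsquares *)

Section PaleyLabels.
Variables (F K : finFieldType) (gF : F) (g : K) (z : algC).
Local Notation p := #|F|.
Local Notation d := p.+1.
Local Notation q := #|K|.
Hypothesis gF_prim : (p.-1).-primitive_root gF.
Hypothesis F_odd : odd p.
Hypothesis g_prim : (q.-1).-primitive_root g.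
Hypothesis q_mod : (2 * d %| q.-1)%N.
Hypothesis z_prim : d.-primitive_root z.
Hypothesis q_large : (weil_defect d p)%:R * sqrtC q%:R + (p * d ^ p.-1)%:R < q%:R :> algC.
Local Notation chi := (mchar g z).
Local Notation A := (paley_block gF).
Local Notation E := (paley_edges gF).

(** The edges from a to a + delta are also those from a + delta with difference
    - delta, and must receive the same classes; one of delta, - delta is chosen. *)
Definition half_rep (delta : F) : F :=
  if (enum_rank delta <= enum_rank (- delta))%N then delta else - delta.

Lemma half_repN delta : half_rep (- delta) = half_rep delta.
Proof.
rewrite /half_rep opprK; case: ltngtP => // /val_inj/enum_rank_inj.
by move=> ->.
Qed.

Lemma half_repP delta : half_rep delta = delta \/ half_rep delta = - delta.
Proof. by rewrite /half_rep; case: ifP; [left|right]. Qed.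

Lemma half_rep_id delta : half_rep (half_rep delta) = half_rep delta.
Proof. by case: (half_repP delta) => E; rewrite E ?half_repN E. Qed.

Lemma half_rep_eq0 delta : (half_rep delta == 0) = (delta == 0).
Proof. by case: (half_repP delta) => ->; rewrite ?oppr_eq0. Qed.

(** The position of the oriented edge in the list of all edges of its difference;
    this is a bijection with the classes by [card_paley_edges]. *)
Definition edge_class beta (s : bool) u v : nat :=
  let delta := half_rep (v - u) in
  index (beta, if v - u == delta then u else v, s) (enum (E delta)).

Lemma edge_classC beta s u v : edge_class beta s u v = edge_class beta s v u.
Proof.
have [->//|ne_uv] := eqVneq u v.
rewrite /edge_class -[u - v]opprB half_repN opprB.
have nz : v - u != 0 by rewrite subr_eq0 eq_sym.
have ne : - (v - u) != v - u.
  by rewrite -subr_eq0 -opprD oppr_eq0 -mulr2n -mulr_natl mulf_neq0 ?(odd_finField_two_neq0 F_odd).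
congr (index (_, _, _) _).
case: (half_repP (v - u)) => ->.
  by rewrite eqxx -[u - v]opprB (negPf ne).
by rewrite opprB eqxx eq_sym -[u - v]opprB (negPf ne).
Qed.

Definition vertices : {set bool * F} := [set x | x.2 \in A x.1].

Lemma card_vertices : #|vertices| = d.
Proof.
apply/eqP; rewrite -(eqn_pmul2l (isT : 0 < 2)%N); apply/eqP.
have -> : #|vertices| = (\sum_(beta : bool) #|A beta|)%N.
  rewrite -sum1_card big_mkcond /=.
  transitivity (\sum_(beta : bool) \sum_(a : F) if a \in A beta then 1%N else 0%N)%N.
    by rewrite pair_bigA; apply: eq_bigr => -[beta a] _; rewrite inE.
  by apply: eq_bigr => beta _; rewrite -big_mkcond sum1_card.
by rewrite big_bool mulnDr !(card_paley_block gF_prim F_odd) mul2n addnn.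
Qed.

Lemma class_nth (T : finType) (X : {set T}) (x0 : T) y : #|X| = d -> y != 0 ->
  exists2 x, x \in X & chi y = z ^+ index x (enum X).
Proof.
move=> cardX nz_y; have [k ->] := prim_rootP z_prim (mchar_unity g z_prim nz_y).
have ltk : (k < size (enum X))%N by rewrite -cardE cardX.
exists (nth x0 (enum X) k); first by rewrite -mem_enum mem_nth.
by rewrite index_uniq ?enum_uniq.
Qed.

(** The class of a label is prescribed as its position in the list of all vertices,
    and those of sums and differences of labels by [edge_class].  Since every
    position occurs, every class is attained. *)
Lemma paley_labels : exists l : bool -> F -> K,
  [/\ forall beta a, a \in A beta -> l beta a != 0,
      forall y, y != 0 -> exists beta a, a \in A beta /\ chi (l beta a) = chi y &
      forall delta y, delta != 0 -> y != 0 ->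
        exists beta a (s : bool), [/\ a \in A beta, a + delta \in A beta &
          chi (l beta (a + delta) + (-1) ^+ s * l beta a) = chi y]].
Proof.
have lP beta : exists l : F -> K,
    {in A beta, forall a, chi (l a) = z ^+ index (beta, a) (enum vertices)} /\
    {in A beta &, forall u v, u != v ->
       chi (l u - l v) = z ^+ edge_class beta false u v /\
       chi (l u + l v) = z ^+ edge_class beta true u v}.
  have [||||l [lv le]] := @labelling K g p z g_prim q_mod z_prim q_large _ (enum (A beta))
     (fun a => index (beta, a) (enum vertices)) (edge_class beta).
  - exact: enum_uniq.
  - by rewrite -cardE (card_paley_block gF_prim F_odd).
  - move=> u v; rewrite !mem_enum => Au Av /eqP; rewrite (eq_prim_root_expr z_prim).
    have lt_d w : w \in A beta -> (index (beta, w) (enum vertices) < d)%N.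
      by move=> Aw; rewrite -card_vertices cardE index_mem mem_enum inE.
    rewrite !modn_small ?lt_d // => /eqP.
    move=> ie; suff [] : (beta, u) = (beta, v) by [].
    by apply: (index_inj (true, 0) _ _ ie); rewrite mem_enum inE.
  - by move=> s u v; apply: edge_classC.
  by exists l; split=> [u Au|u v Au Av]; [apply: lv|apply: le]; rewrite mem_enum.
have [l lP'] := fin_all_exists lP; exists l; split.
- move=> beta a Aa; have [lv _] := lP' beta.
  by rewrite -(mchar_eq0 g z_prim) lv // expf_neq0 // (prim_root_neq0 z_prim).
- move=> y nz_y; have [[beta a] Va ->] := class_nth (true, 0) card_vertices nz_y.
  have Aa : a \in A beta by rewrite inE in Va.
  by exists beta, a; split=> //; have [lv _] := lP' beta; apply: lv.
move=> delta y nz_d nz_y.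
have nz_hd : half_rep delta != 0 by rewrite half_rep_eq0.
have [[[beta u] s] Eu ->] := class_nth (true, 0, true) (card_paley_edges gF_prim F_odd nz_hd) nz_y.
have /andP[/= Au Auh] : (u \in A beta) && (u + half_rep delta \in A beta) by move: Eu; rewrite inE.
have ec : edge_class beta s u (u + half_rep delta) = index (beta, u, s) (enum (E (half_rep delta))).
  by rewrite /edge_class [u + _ - u]addrC addKr half_rep_id eqxx.
have ne : u != u + half_rep delta by rewrite -subr_eq0 opprD addNKr oppr_eq0.
have [_ le] := lP' beta; have [lm lp] := le _ _ Au Auh ne.
exists beta; case: (half_repP delta) => hd; rewrite hd in Auh ec lm lp *.
- exists u, (~~ s); split=> //; rewrite -ec.
  case: s ec {Eu} => ec; last by rewrite expr1 mulN1r -(mcharN g_prim q_mod z_prim) opprB.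
  by rewrite expr0 mul1r addrC.
- exists (u - delta), (~~ s); rewrite subrK; split=> //; rewrite -ec.
  by case: s ec {Eu} => ec; rewrite ?expr0 ?expr1 ?mul1r ?mulN1r.
Qed.
End PaleyLabels.

(** * The base blocks *)

(** To count every element exactly once it is enough to meet every element and to
    compare the lengths. *)
Lemma perm_eq_cover (T : eqType) (s t : seq T) :
  uniq t -> {subset t <= s} -> (size s <= size t)%N -> perm_eq s t.
Proof.
move=> Ut ts szs; have [_ ts_mem] := uniq_min_size Ut ts szs.
rewrite perm_sym uniq_perm // ?(leq_size_uniq Ut ts szs) //.
Qed.

Lemma size_flatten_const (T S : eqType) (f : T -> seq S) n (s : seq T) :
  {in s, forall x, size (f x) = n} -> size (flatten [seq f x | x <- s]) = (size s * n)%N.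
Proof.
move=> fn; rewrite size_flatten /shape -map_comp sumnE big_map.
rewrite (eq_big_seq (fun=> n)) => [|x /fn //].
by rewrite big_const_seq count_predT iter_addn_0 mulnC.
Qed.

Section Assembly.
Variables (F K : finFieldType) (gF : F) (g : K) (z : algC).
Local Notation p := #|F|.
Local Notation d := p.+1.
Local Notation q := #|K|.
Hypothesis gF_prim : (p.-1).-primitive_root gF.
Hypothesis F_odd : odd p.
Hypothesis g_prim : (q.-1).-primitive_root g.
Hypothesis q_mod : (2 * d %| q.-1)%N.
Hypothesis z_prim : d.-primitive_root z.
Local Notation chi := (mchar g z).
Local Notation A := (paley_block gF).

Let d_dvd : (d %| q.-1)%N.
Proof. by apply: dvdn_trans q_mod; apply: dvdn_mull. Qed.

Let two0 : 2%:R != 0 :> K := two_neq0 q_mod.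

(** Sum chi x ^+ a over a < d and over x in both orders. *)
Lemma card_mchar_kernel : (d * #|[set x | (chi x == 1)%R]| = q.-1)%N.
Proof.
apply/eqP; rewrite -(eqr_nat algC) -subn1 natrB ?(ltnW (finNzRing_gt1 K)) //; apply/eqP.
have : \sum_x \sum_(a < d) chi x ^+ a = q%:R.
  rewrite exchange_big big_ord_recl /= [X in _ + X]big1 ?addr0 => [|a _].
    rewrite (eq_bigr (fun=> 1)) => [|x _]; last by rewrite expr0.
    by rewrite sumr_const.
  by rewrite (sum_mchar_exp g_prim d_dvd z_prim) // gtnNdvd // ltnS ltn_ord.
move=> <-; rewrite (bigD1 0) //= mchar0.
have -> : \sum_(a < d) (0 : algC) ^+ a = 1.
  by rewrite big_ord_recl big1 ?addr0 ?expr0 // => a _; rewrite expr0n.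
rewrite addrC addrK natrM -(sum1_card (mem [set x | chi x == 1])) natr_sum.
rewrite mulr_sumr big_mkcond [RHS]big_mkcond /=.
apply: eq_bigr => x _; rewrite inE; have [->|nz_x] := eqVneq x 0.
  by rewrite mchar0 eq_sym oner_eq0.
by rewrite /= (sum_unity_root (mchar_unity g z_prim nz_x)) mulr1; case: ifP.
Qed.

(** Representatives modulo {1, -1} of the group of d-th powers. *)
Definition multipliers : {set K} :=
  [set s | (chi s == 1) && (enum_rank s < enum_rank (- s))%N].

Lemma multiplierP c : chi c = 1 -> exists2 s, s \in multipliers & exists e : bool, c = (-1) ^+ e * s.
Proof.
move=> chi_c; have nz_c : c != 0 by rewrite -(mchar_eq0 g z_prim) chi_c oner_eq0.
case: (ltngtP (enum_rank c) (enum_rank (- c))) => [lt|lt|/val_inj/enum_rank_inj/eqP].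
- by exists c; [rewrite inE chi_c eqxx|exists false; rewrite mul1r].
- exists (- c); last by exists true; rewrite expr1 mulrNN mul1r.
  by rewrite inE (mcharN g_prim q_mod z_prim) chi_c eqxx opprK.
by rewrite -subr_eq0 opprK -mulr2n -mulr_natl mulf_eq0 (negPf two0) (negPf nz_c).
Qed.

Lemma card_multipliers : (#|multipliers| * (2 * d) = q.-1)%N.
Proof.
rewrite -card_mchar_kernel mulnA mulnC; congr (_ * _)%N.
set D := [set x | chi x == 1].
have -> : D = multipliers :|: [set - s | s in multipliers].
  apply/setP=> x; rewrite inE in_setU; apply/eqP/orP => [/multiplierP[s Ms [[] ->]]|].
  - by right; apply/imsetP; exists s; rewrite // expr1 mulN1r.
  - by left; rewrite expr0 mul1r.
  case=> [|/imsetP[s + ->]]; rewrite inE => /andP[/eqP chi_s _] //.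
  by rewrite (mcharN g_prim q_mod z_prim).
rewrite cardsU (_ : _ :&: _ = set0) ?cards0 ?subn0; last first.
  apply/setP=> x; rewrite !inE; apply/negP=> /andP[/andP[_ lt1] /imsetP[s]].
  rewrite inE => /andP[_ lt2] xE; move: lt1; rewrite xE opprK => /(ltn_trans lt2).
  by rewrite ltnn.
by rewrite card_imset ?addnn ?mul2n ?muln2 //; apply: oppr_inj.
Qed.

Variable l : bool -> F -> K.
Hypothesis l_neq0 : forall beta a, a \in A beta -> l beta a != 0.
Hypothesis l_vertices : forall y, y != 0 -> exists beta a, a \in A beta /\ chi (l beta a) = chi y.
Hypothesis l_edges : forall delta y, delta != 0 -> y != 0 ->
  exists beta a (s : bool), [/\ a \in A beta, a + delta \in A beta &
    chi (l beta (a + delta) + (-1) ^+ s * l beta a) = chi y].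

Definition block_point beta (s : K) (u : F * bool) : F * K := (u.1, (-1) ^+ u.2 * (s * l beta u.1)).

Definition base_block beta (s : K) : {set F * K} :=
  block_point beta s @: setX (A beta) [set: bool].

Definition base_blocks : seq {set F * K} :=
  [seq base_block beta s | beta <- [:: true; false], s <- enum multipliers].

Lemma mem_base_block beta s a (e : bool) : a \in A beta ->
  (a, (-1) ^+ e * (s * l beta a)) \in base_block beta s.
Proof. by move=> Aa; apply/imsetP; exists (a, e); rewrite // in_setX Aa inE. Qed.

Lemma mem_base_blocks beta s : s \in multipliers -> base_block beta s \in base_blocks.
Proof.
by move=> Ms; apply/allpairsP; exists (beta, s); rewrite mem_enum; split=> //; case: beta.
Qed.

Lemma size_base_blocks : size base_blocks = (2 * #|multipliers|)%N.
Proof. by rewrite size_allpairs -cardE. Qed.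

Lemma card_base_block B : B \in base_blocks -> #|B| = d.
Proof.
case/allpairsP=> -[beta s] /= [_]; rewrite mem_enum inE => /andP[/eqP chi_s _] ->.
have nz_s : s != 0 by rewrite -(mchar_eq0 g z_prim) chi_s oner_eq0.
rewrite card_in_imset ?cardsX ?cardsT ?card_bool.
  by rewrite mulnC (card_paley_block gF_prim F_odd).
move=> [a e] [a' e']; rewrite !in_setX /= => /andP[Aa _] _ [<- /mulIf].
rewrite mulf_neq0 ?nz_s ?l_neq0 // => /(_ isT) ee'; congr (_, _).
have ne1 : (-1 == 1 :> K) = false.
  by apply/negbTE; rewrite -subr_eq0 -opprD oppr_eq0 -mulr2n two0.
move/eqP: ee'; case: e; case: e' => //; rewrite expr0 expr1 ?ne1 //.
by rewrite eq_sym ne1.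
Qed.

(** y / l a is a d-th power for some label l a, hence of the form e s.  The point
    with the opposite sign is in the same block; this also yields the
    differences with first coordinate 0. *)
Lemma cover_second_coordinate y : y != 0 ->
  exists2 B, B \in base_blocks & exists2 a, (a, y) \in B & (a, - y) \in B.
Proof.
move=> nz_y; have [beta [a [Aa chi_y]]] := l_vertices nz_y.
have chi_c : chi (y / l beta a) = 1.
  have := mcharM g_prim d_dvd z_prim (y / l beta a) (l beta a).
  rewrite divfK ?l_neq0 // chi_y -[LHS]mul1r => /mulIf -> //.
  by rewrite (mchar_eq0 g z_prim).
have [s Ms [e cE]] := multiplierP chi_c.
have yE : y = (-1) ^+ e * (s * l beta a) by rewrite mulrA -cE divfK ?l_neq0.
exists (base_block beta s); first exact: mem_base_blocks.
exists a; first by rewrite {1}yE mem_base_block.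
have -> : - y = (-1) ^+ (~~ e) * (s * l beta a).
  by rewrite yE; case: (e); rewrite ?expr0 ?expr1 ?mulN1r ?opprK mul1r.
exact: mem_base_block.
Qed.

Lemma cover_differences delta y : y != 0 ->
  exists2 B, B \in base_blocks & exists u v, [/\ u \in B, v \in B, u.1 - v.1 = delta & u.2 - v.2 = y].
Proof.
move=> nz_y; have [->|nz_d] := eqVneq delta 0.
  have nz_y2 : y / 2%:R != 0 by rewrite mulf_neq0 ?invr_eq0.
  have [B BB [a Ba Ba']] := cover_second_coordinate nz_y2.
  exists B => //; exists (a, y / 2%:R), (a, - (y / 2%:R)); split=> //=; first by rewrite subrr.
  by rewrite opprK -mulrDr -mulr2n -[_ *+ 2]mulr_natr mulVf ?mulr1.
have [beta [a [s [Aa Aad chi_y]]]] := l_edges nz_d nz_y.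
set m := l beta _ + _ in chi_y.
have nz_m : m != 0 by rewrite -(mchar_eq0 g z_prim) chi_y (mchar_eq0 g z_prim).
have chi_c : chi (y / m) = 1.
  have := mcharM g_prim d_dvd z_prim (y / m) m.
  rewrite divfK // chi_y -[LHS]mul1r => /mulIf -> //.
  by rewrite (mchar_eq0 g z_prim).
have [t Mt [e cE]] := multiplierP chi_c.
exists (base_block beta t); first exact: mem_base_blocks.
exists (a + delta, (-1) ^+ e * (t * l beta (a + delta))), (a, (-1) ^+ (~~ (e (+) s)) * (t * l beta a)).
split=> /=; rewrite ?mem_base_block //; first by rewrite addrC addKr.
rewrite -[RHS](divfK nz_m) cE /m mulrDr mulrA; congr (_ + _).
by case: (e); case: (s); rewrite /= ?expr0 ?expr1 ?mulN1r ?mul1r ?mulNr ?mulrN ?opprK.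
Qed.

Lemma base_blocks_FDF : is_elementary_FDF (first_factor F K) (p + 1) 1 base_blocks.
Proof.
have cardN : #|first_factor F K| = p by rewrite cardsX cardsT cards1 muln1.
have q_gt0 : (0 < q)%N := ltnW (finNzRing_gt1 K).
have memN (x : F * K) : (x \in first_factor F K) = (x.2 == 0) by case: x => a b; rewrite [LHS]in_setX inE in_set1.
have cardT : #|{: F * K}| = (p * q)%N by rewrite card_prod.
have size_cover : (size base_blocks * d = q.-1)%N.
  by rewrite size_base_blocks [(2 * _)%N]mulnC -mulnA card_multipliers.
split; last by rewrite mul1n cardN addnK.
split.
  split.
  - by apply/centsP=> -[a y] _ [b w] _; congr (_, _); apply: addrC.
  - by move=> B /card_base_block ->; rewrite addn1.
  rewrite /= cats0; apply: perm_eq_cover; first exact: enum_uniq.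
    move=> [delta y]; rewrite mem_enum inE memN /= => nz_y.
    have [B BB [u [v [Bu Bv uv1 uv2]]]] := cover_differences delta nz_y.
    apply/flatten_mapP; exists B => //; apply/allpairsPdep; exists u, v; split.
    - by rewrite mem_enum.
    - rewrite mem_enum in_setD1 Bv andbT; apply: contraNneq nz_y => uv.
      by rewrite -uv2 uv subrr.
    by rewrite -uv1 -uv2.
  rewrite (@size_flatten_const _ _ _ (d * p)) => [|B /card_base_block cardB]; last first.
    rewrite size_allpairs_dep sumnE big_map (eq_big_seq (fun=> p)) => [|x]; last first.
      by rewrite mem_enum -cardE => Bx; move: cardB; rewrite (cardsD1 x) Bx => -[].
    by rewrite big_const_seq count_predT iter_addn_0 -cardE cardB mulnC.
  by rewrite mulnA size_cover -cardE cardsCs setCK cardT cardN mulnC -subn1 mulnBr muln1.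
exists [:: base_blocks]; split.
- by rewrite /= cats0.
- by rewrite /= mul1n addnK mul1n cardN.
move=> P; rewrite inE => /eqP->; split.
  rewrite cardN cardT addn1 mulnCA size_cover.
  by rewrite -subn1 mulnBr muln1.
rewrite /nontrivial_coset_reps; apply: perm_eq_cover; first exact: enum_uniq.
  move=> C; rewrite mem_enum in_setD1 => /andP[neC /rcosetsP[x _ CE]].
  have nz_x : x.2 != 0.
    by apply: contraNneq neC => x0; rewrite CE rcoset_id // memN x0.
  have [B BB [a Ba _]] := cover_second_coordinate nz_x.
  rewrite CE; apply/mapP; exists (a, x.2).
    by apply/flatten_mapP; exists B; rewrite ?mem_enum.
  by apply/rcoset_eqP; rewrite mem_rcoset memN; apply/eqP; apply: subrr.
rewrite size_map (@size_flatten_const _ _ _ d) => [|B /card_base_block <-]; last by rewrite cardE.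
rewrite size_cover -cardE.
have := cardsD1 (first_factor F K : {set F * K}) (rcosets (first_factor F K) [set: F * K]).
have -> : #|rcosets (first_factor F K) [set: F * K]| = q.
  rewrite -[LHS]/(indexg [set: F * K]%G (first_factor F K)) -divgS ?subsetT // cardsT cardT cardN.
  by rewrite mulKn // ltnW // finNzRing_gt1.
have -> : ((first_factor F K : {set F * K}) \in rcosets (first_factor F K) [set: F * K]).
  by apply/rcosetsP; exists 1%g; rewrite ?inE // rcoset1.
by move=> /(congr1 predn) /= ->.
Qed.
End Assembly.

Unset Implicit Arguments.

Theorem theorem4p10 (R : rcfType) (p q : nat) (F K : finFieldType)
  (p_pp : prime_power p) (p_mod4 : (p = 1 %[mod 4])%N)
  (q_pp : prime_power q) (q_mod : (q = 1 %[mod 2 * p + 2])%N)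
  (q_gt : Qbound R (p + 1) p < q%:R)
  (cardF : #|F| = p) (cardK : #|K| = q) :
  exists Bs : seq {set (F * K)%type},
    is_elementary_FDF (first_factor F K) (p + 1) 1 Bs.
Proof.
subst p q.
have F_odd : odd #|F|.
  by rewrite -[odd _]negbK -dvdn2; apply/negP => two_p; move: p_mod4 two_p; lia.
have q_gt1 : (1 < #|K|)%N := finNzRing_gt1 K.
have q_dvd : (2 * #|F|.+1 %| #|K|.-1)%N.
  by rewrite -subn1 -(eqn_mod_dvd _ (ltnW q_gt1)) mulnS addnC; apply/eqP.
rewrite addn1 in q_gt; have q_large := Qbound_weil_defect (ltn0Sn _) q_gt.
have [gF gF_prim] := finField_prim_root F.
have [g g_prim] := finField_prim_root K.
have [z z_prim] := C_prim_root_exists (ltn0Sn #|F|).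
have [l [l_neq0 l_vertices l_edges]] := paley_labels gF_prim F_odd g_prim q_dvd z_prim q_large.
exists (base_blocks gF g z l).
exact: (base_blocks_FDF gF_prim F_odd g_prim q_dvd z_prim l_neq0 l_vertices l_edges).
Qed.
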